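(* Let $n\ge 1$, $\alpha\in(0,1)$ and $0<R_1<R_2<\infty$. Let $g=g(x,\rho)$ be a positive function of class $C^{1,\alpha}$ in the annulus $\mathcal{A}:=\{(x,\rho): x\in\mathbb{S}^n,\ \rho\in[R_1,R_2]\}$ such that $$(i)\ \ g(x,R_1)\ge 1\qquad\text{and}\qquad (ii)\ \ g(x,R_2)\le 1\qquad\text{for all } x\in\mathbb{S}^n.$$ Consider the equation $$S_1(\lambda_1(\rho(x)),\dots,\lambda_n(\rho(x)))=n\,g(x,\rho(x)),\qquad x\in\mathbb{S}^n. \tag{$*$}$$ Let $R^1$ and $R^2$ be two hypersurfaces in $\mathcal{M}^n(\mathbb{S}^n)$ with radial functions $\rho^1$ and $\rho^2$, with values in $[R_1,R_2]$, satisfying $( * )$. If, in addition, $$\frac{\partial g}{\partial\rho}(x,\rho)\le 0\qquad\text{for all }(x,\rho)\in\mathbb{S}^n\times[R_1,R_2],$$ then there is a constant $C>0$ such that $\rho^1(x)=C\rho^2(x)$ for all $x\in\mathbb{S}^n$. Furthermore, each solution $\rho\in C^2(\mathbb{S}^n)$ of $( * )$ such that $R_1\le\rho(x)\le R_2$ for all $x\in\mathbb{S}^n$ is either identically equal to $R_1$, or identically equal to $R_2$, or satisfies $R_1<\rho(x)<R_2$ for all $x\in\mathbb{S}^n$.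
   Context: $\mathbb{S}^n$ is the unit sphere in $\mathbb{R}^{n+1}$ centered at the origin $\mathcal{O}$, with standard metric $e=e_{ij}du^idu^j$ induced from $\mathbb{R}^{n+1}$, gradient $\nabla$, Hessian $\nabla^2$ and Laplace operator $\Delta$ with respect to $e$; $[e^{ij}]=[e_{ij}]^{-1}$. We write $\mathbb{R}^{n+1}\setminus\{\mathcal{O}\}=\mathbb{S}^n\times(0,\infty)$ via $(x,\rho)\mapsto\rho x$. $\mathcal{M}^n(\mathbb{S}^n)$ is the set of closed hypersurfaces $R\subset\mathbb{R}^{n+1}$ given by a position vector $r(x)=\rho(x)x$, $x\in\mathbb{S}^n$, with $\rho\in C^2(\mathbb{S}^n)$, $\rho:\mathbb{S}^n\to(0,\infty)$; $\rho$ is called the radial function of $R$. (In $\rho^1,\rho^2$, $R^1,R^2$ the superscripts are labels, not powers.) The reflection map of $R$ is $\gamma_R(x)=x-2\langle x,N(x)\rangle N(x)$, where $N$ is the unit normal field on $R$. The intensity form is $\kappa=\kappa_{ij}du^idu^j$ with $\kappa_{ij}=-\langle\partial_i r,\partial_j\gamma_R\rangle/\rho$; in terms of $\rho$, $$\kappa=\frac{-\rho\nabla^2\rho+2\nabla\rho\otimes\nabla\rho+\tfrac12(\rho^2-|\nabla\rho|^2)e}{\tfrac12(\rho^2+|\nabla\rho|^2)}.$$ The principal intensities $\lambda_1,\dots,\lambda_n$ of $R$ at $x$ are the eigenvalues of the matrix $[e^{is}\kappa_{sj}]$ at $x$, and $S_1=\lambda_1+\dots+\lambda_n=e^{ij}\kappa_{ij}$.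 Explicitly, $$S_1(\lambda_1(\rho),\dots,\lambda_n(\rho))=\frac{-\rho\Delta\rho+n\rho^2+2|\nabla\rho|^2-\tfrac n2(\rho^2+|\nabla\rho|^2)}{\tfrac12(\rho^2+|\nabla\rho|^2)}.$$ *)

(* Defs.v *)
From HB Require Import structures.
From mathcomp Require Import all_boot all_order all_algebra.
From mathcomp Require Import all_classical all_reals all_analysis.

Set Implicit Arguments.
Unset Strict Implicit.
Unset Printing Implicit Defensive.

Import Order.TTheory GRing.Theory Num.Theory.
Import numFieldNormedType.Exports.

Local Open Scope classical_set_scope.
Local Open Scope ring_scope.

(* R^{n+1} is 'rV[R]_n.+1.  The library norm `|v| on it is the sup norm, hence
   the separate Euclidean structure; both define the same topology. *)
Definition dot (R : realType) (n : nat) (u v : 'rV[R]_n) : R :=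
  \sum_(i < n) u 0 i * v 0 i.

Definition enorm (R : realType) (n : nat) (u : 'rV[R]_n) : R :=
  Num.sqrt (dot u u).

Definition sphere (R : realType) (n : nat) : set 'rV[R]_n.+1 :=
  [set x | enorm x = 1].

(* The retraction y |-> y / |y| of the punctured space onto the sphere. *)
Definition unitize (R : realType) (n : nat) (y : 'rV[R]_n) : 'rV[R]_n :=
  (enorm y)^-1 *: y.

(* C^k on an open set U.  Differentiability is required in Frechet's sense at
   each order; in finite dimension this is the usual notion. *)
Fixpoint Ck (R : realType) (V W : normedModType R) (k : nat) (U : set V)
    (f : V -> W) : Prop :=
  if k is k'.+1 then
    (forall x, U x -> differentiable f x) /\
    (forall v, Ck k' U (fun x => 'D_v f x))
  else forall x, U x -> {for x, continuous f}.

(* A function on the sphere is represented by a function on R^{n+1} whose values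
   off the sphere are ignored.  It is differentiated through its extension
   F \o unitize, homogeneous of degree 0, so that C^k on the embedded sphere
   is C^k of this extension off the origin. *)
Definition Ck_sphere (R : realType) (n k : nat) (f : 'rV[R]_n.+1 -> R) : Prop :=
  Ck k [set y | y != 0] (f \o @unitize R n.+1).

(* For x on the sphere and v tangent to the sphere at x, this is the
   derivative dF_x(v) of F along v. *)
Definition sderive (R : realType) (n : nat) (W : normedModType R)
    (F : 'rV[R]_n.+1 -> W) (x v : 'rV[R]_n.+1) : W :=
  'D_v (F \o @unitize R n.+1) x.

Definition position (R : realType) (n : nat) (rho : 'rV[R]_n.+1 -> R)
    (x : 'rV[R]_n.+1) : 'rV[R]_n.+1 := rho x *: x.

(* M is an element of M^n(S^n), with radial function rho. *)
Definition is_radial_function (R : realType) (n : nat)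
    (M : set 'rV[R]_n.+1) (rho : 'rV[R]_n.+1 -> R) : Prop :=
  [/\ Ck_sphere 2 rho,
      forall x, sphere x -> 0 < rho x
    & M = position rho @` @sphere R n].

(* N x is the unit normal at the point r(x).  It is determined up to sign,
   which does not affect the reflection map. *)
Definition unit_normal_field (R : realType) (n : nat)
    (rho : 'rV[R]_n.+1 -> R) (N : 'rV[R]_n.+1 -> 'rV[R]_n.+1) : Prop :=
  forall x, sphere x ->
    enorm (N x) = 1 /\
    (forall v, dot v x = 0 -> dot (sderive (position rho) x v) (N x) = 0).

Definition reflection_map (R : realType) (n : nat)
    (N : 'rV[R]_n.+1 -> 'rV[R]_n.+1) (x : 'rV[R]_n.+1) : 'rV[R]_n.+1 :=
  x - (2 * dot x (N x)) *: N x.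

(* The rows of E form a basis of the tangent space of the sphere at x: they are
   the coordinate vectors d/du^1, ..., d/du^n of a local coordinate system. *)
Definition tangent_frame (R : realType) (n : nat) (x : 'rV[R]_n.+1)
    (E : 'M[R]_(n, n.+1)) : Prop :=
  row_free E /\ (forall i, dot (row i E) x = 0).

Definition metric_mx (R : realType) (n : nat) (E : 'M[R]_(n, n.+1)) : 'M[R]_n :=
  \matrix_(i, j) dot (row i E) (row j E).

(* kappa_ij = - <d_i r, d_j gamma> / rho *)
Definition intensity_mx (R : realType) (n : nat) (rho : 'rV[R]_n.+1 -> R)
    (N : 'rV[R]_n.+1 -> 'rV[R]_n.+1) (x : 'rV[R]_n.+1)
    (E : 'M[R]_(n, n.+1)) : 'M[R]_n :=
  \matrix_(i, j) (- dot (sderive (position rho) x (row i E))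
                        (sderive (reflection_map N) x (row j E)) / rho x).

(* lam lists the eigenvalues, with multiplicity, of [e^{is} kappa_sj] at x; they
   do not depend on the frame. *)
Definition principal_intensities (R : realType) (n : nat)
    (rho : 'rV[R]_n.+1 -> R) (N : 'rV[R]_n.+1 -> 'rV[R]_n.+1)
    (x : 'rV[R]_n.+1) (lam : 'I_n -> R) : Prop :=
  exists2 E : 'M[R]_(n, n.+1), tangent_frame x E &
    char_poly (invmx (metric_mx E) *m intensity_mx rho N x E)
      = \prod_(i < n) ('X - (lam i)%:P).

Definition S1 (R : realType) (n : nat) (lam : 'I_n -> R) : R :=
  \sum_(i < n) lam i.

(* rho satisfies S_1(lambda_1, ..., lambda_n) = n g(x, rho(x)) on the sphere. *)
Definition solves (R : realType) (n : nat) (g : 'rV[R]_n.+1 -> R -> R)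
    (rho : 'rV[R]_n.+1 -> R) : Prop :=
  exists2 N, unit_normal_field rho N &
    forall x, sphere x ->
      exists2 lam, principal_intensities rho N x lam &
        S1 lam = n%:R * g x (rho x).

(* g(x, rho), seen as a function of the point rho x of R^{n+1}, is of class
   C^{1,alpha} on the closed annulus R1 <= rho <= R2: it is continuous there and
   C^1 inside, and its gradient extends to the closed annulus as a
   Hoelder continuous field DG of exponent alpha. *)
Definition C1alpha_annulus (R : realType) (n : nat) (alpha R1 R2 : R)
    (g : 'rV[R]_n.+1 -> R -> R) : Prop :=
  let A := [set y : 'rV[R]_n.+1 | R1 <= enorm y <= R2] in
  let G := fun y : 'rV[R]_n.+1 => g (unitize y) (enorm y) in
  {within A, continuous G} /\
  exists DG : 'rV[R]_n.+1 -> 'rV[R]_n.+1,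
    (forall y, R1 < enorm y < R2 ->
       differentiable G y /\ forall v, 'D_v G y = dot (DG y) v) /\
    (exists K : R, forall y z, A y -> A z ->
       enorm (DG y - DG z) <= K * enorm (y - z) `^ alpha).

(* The derivative of f : [a, b] -> R at t in [a, b], one-sided at the
   endpoints; values of f outside [a, b] are not used. *)
Definition derive_on (R : realType) (a b : R) (f : R -> R) (t : R) : R :=
  lim ((f s - f t) / (s - t) @[s --> within `[a, b] t^']).

(* Main.v *)
Require Import Defs.
From mathcomp Require Import all_boot all_order all_algebra.
From mathcomp Require Import all_classical all_reals all_analysis.
From mathcomp Require Import ring lra.

(** Put V = - ln rho, extended to the punctured space with degree 0, and let q be
    its gradient. The normal of the hypersurface is proportional to x + q, and
    the trace of the intensity form is
      S1 = - n + 2 (n + Laplacian V + |q|^2) / (1 + |q|^2),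
    so that the equation becomes (lemma [solves_equation])
      Laplacian V = n (1 + g) / 2 (1 + |q|^2) - n - |q|^2.
    The unknown V enters the right-hand side only through g. All three
    assertions then follow from one strong maximum principle on the sphere
    (lemma [strong_maximum]): if a function W attains its maximum M, and
      Laplacian W >= - C (M - W) - B |grad W|
    wherever W is close to M, then W is constant.

    For two solutions, W = V1 - V2 satisfies this inequality where it is
    positive, because g is nonincreasing in rho (lemma [solutions_homothetic]).
    If W, or by symmetry - W, is positive somewhere, then W is constant, which
    means that rho1 and rho2 are proportional; otherwise rho1 = rho2.

    For one solution which touches the value R1, V has the maximum - ln R1. The
    condition g >= 1 at R1 and the Lipschitz bound on g along rays, which comes
    from the C^{1,alpha} regularity up to the boundary, give the inequality with
    W = V (lemma [constant_of_touching_inner]). The value R2 is treated in the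
    same way with W = - V (lemma [constant_of_touching_outer]).

    Functions on the sphere are replaced throughout by their extensions of
    degree 0: at a point of the sphere, the Laplace-Beltrami operator and the
    gradient are then the flat Laplacian and the flat gradient. *)

Import Order.TTheory GRing.Theory Num.Theory.
Import numFieldNormedType.Exports.

Local Open Scope classical_set_scope.
Local Open Scope ring_scope.

Set Implicit Arguments.
Unset Strict Implicit.

(** * Euclidean inner product, sphere and retraction *)

Lemma dotC {R : realType} {n} (u v : 'rV[R]_n) : dot u v = dot v u.
Proof. by apply: eq_bigr => i _; rewrite mulrC. Qed.

Lemma dotDl {R : realType} {n} (u v w : 'rV[R]_n) :
  dot (u + v) w = dot u w + dot v w.
Proof. by rewrite -big_split; apply: eq_bigr => i _; rewrite mxE mulrDl. Qed.

Lemma dotZl {R : realType} {n} c (u w : 'rV[R]_n) : dot (c *: u) w = c * dot u w.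
Proof. by rewrite mulr_sumr; apply: eq_bigr => i _; rewrite mxE mulrA. Qed.

Lemma dotDr {R : realType} {n} (u v w : 'rV[R]_n) :
  dot w (u + v) = dot w u + dot w v.
Proof. by rewrite dotC dotDl !(dotC w). Qed.

Lemma dotZr {R : realType} {n} c (u w : 'rV[R]_n) : dot w (c *: u) = c * dot w u.
Proof. by rewrite dotC dotZl dotC. Qed.

Lemma dotNl {R : realType} {n} (u w : 'rV[R]_n) : dot (- u) w = - dot u w.
Proof. by rewrite -scaleN1r dotZl mulN1r. Qed.

Lemma dotNr {R : realType} {n} (u w : 'rV[R]_n) : dot w (- u) = - dot w u.
Proof. by rewrite dotC dotNl dotC. Qed.

Lemma dot0l {R : realType} {n} (w : 'rV[R]_n) : dot 0 w = 0.
Proof. by rewrite -(scale0r w) dotZl mul0r. Qed.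

Lemma dot0r {R : realType} {n} (w : 'rV[R]_n) : dot w 0 = 0.
Proof. by rewrite dotC dot0l. Qed.

Definition dotE := (@dotDl, @dotDr, @dotNl, @dotNr, @dotZl, @dotZr).

Lemma dot_delta {R : realType} {n} (u : 'rV[R]_n) i : dot u (delta_mx 0 i) = u 0 i.
Proof.
rewrite /dot (bigD1 i)//= mxE !eqxx mulr1 big1 ?addr0// => j ji.
by rewrite mxE (negPf ji) mulr0.
Qed.

Lemma dot_sum_delta {R : realType} {n} (u v : 'rV[R]_n) :
  dot u v = \sum_i v 0 i * dot u (delta_mx 0 i).
Proof. by apply: eq_bigr => i _; rewrite dot_delta mulrC. Qed.

Lemma dot_ge0 {R : realType} {n} (u : 'rV[R]_n) : 0 <= dot u u.
Proof. by apply: sumr_ge0 => i _; rewrite -expr2 sqr_ge0. Qed.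

Lemma dot_eq0 {R : realType} {n} (u : 'rV[R]_n) : (dot u u == 0) = (u == 0).
Proof.
apply/eqP/eqP => [|->]; last by rewrite dot0l.
move=> /psumr_eq0P H; apply/rowP => i; rewrite mxE; apply/eqP.
by rewrite -sqrf_eq0 expr2; apply/eqP/H => // j _; rewrite -expr2 sqr_ge0.
Qed.

Lemma dot_gt0 {R : realType} {n} (u : 'rV[R]_n) : (0 < dot u u) = (u != 0).
Proof. by rewrite lt_def dot_ge0 andbT dot_eq0. Qed.

Lemma enorm_ge0 {R : realType} {n} (u : 'rV[R]_n) : 0 <= enorm u.
Proof. exact: sqrtr_ge0. Qed.

Lemma enorm_sqr {R : realType} {n} (u : 'rV[R]_n) : enorm u ^+ 2 = dot u u.
Proof. by rewrite sqr_sqrtr// dot_ge0. Qed.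

Lemma enorm_gt0 {R : realType} {n} (u : 'rV[R]_n) : (0 < enorm u) = (u != 0).
Proof. by rewrite sqrtr_gt0 dot_gt0. Qed.

Lemma enormZ {R : realType} {n} c (u : 'rV[R]_n) : enorm (c *: u) = `|c| * enorm u.
Proof.
rewrite /enorm dotZl dotZr mulrA -expr2 sqrtrM ?sqr_ge0//.
by rewrite sqrtr_sqr.
Qed.

Lemma cauchy_schwarz {R : realType} {n} (u v : 'rV[R]_n) :
  `|dot u v| <= enorm u * enorm v.
Proof.
rewrite /enorm -sqrtrM ?dot_ge0// -sqrtr_sqr ler_wsqrtr//.
(* Up to the factor <v,v>, this vector is the part of u orthogonal to v. *)
have := dot_ge0 (dot v v *: u - dot u v *: v).
rewrite !dotE (dotC v u) -!expr2.
have [->|v0] := eqVneq v 0.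
  by rewrite !dot0r expr2 !mulr0.
have vv : 0 < dot v v by rewrite dot_gt0.
move=> H; rewrite -(ler_pM2l vv); nra.
Qed.

Lemma sphereE {R : realType} {n} (x : 'rV[R]_n.+1) : sphere x <-> dot x x = 1.
Proof.
rewrite /sphere/=; split=> [xx|xx]; first by rewrite -enorm_sqr xx expr1n.
by rewrite /enorm xx sqrtr1.
Qed.

Lemma sphere_neq0 {R : realType} {n} (x : 'rV[R]_n.+1) : sphere x -> x != 0.
Proof. by move=> xS; rewrite -enorm_gt0 xS. Qed.

Lemma unitize_sphere {R : realType} {n} (y : 'rV[R]_n.+1) :
  y != 0 -> sphere (unitize y).
Proof.
rewrite -enorm_gt0 /sphere/= /unitize => y0.
by rewrite enormZ gtr0_norm ?invr_gt0// mulVf// gt_eqF.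
Qed.

Lemma unitize_id {R : realType} {n} (x : 'rV[R]_n.+1) : sphere x -> unitize x = x.
Proof. by rewrite /sphere/= /unitize => ->; rewrite invr1 scale1r. Qed.

Lemma unitizeZ {R : realType} {n} c (y : 'rV[R]_n.+1) :
  0 < c -> unitize (c *: y) = unitize y.
Proof.
move=> c0; rewrite /unitize enormZ gtr0_norm// scalerA invfM mulrAC mulVf ?mul1r//.
by rewrite gt_eqF.
Qed.

(** * Directional derivatives *)

Lemma is_derive_add {R : realType} {V : normedModType R} (f g : V -> R) x v a b :
  is_derive x v f a -> is_derive x v g b ->
  is_derive x v (fun y => f y + g y) (a + b).
Proof. exact: is_deriveD. Qed.

Lemma is_derive_mul {R : realType} {V : normedModType R} (f g : V -> R) x v a b :
  is_derive x v f a -> is_derive x v g b ->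
  is_derive x v (fun y => f y * g y) (a * g x + f x * b).
Proof.
move=> fa gb; apply: is_derive_eq (is_deriveM fa gb) _.
by rewrite addrC /GRing.scale/= [g x * _]mulrC.
Qed.

Lemma is_derive_opp {R : realType} {V : normedModType R} (f : V -> R) x v a :
  is_derive x v f a -> is_derive x v (fun y => - f y) (- a).
Proof. exact: is_deriveN. Qed.

Lemma is_derive_scale {R : realType} {V : normedModType R} c (f : V -> R) x v a :
  is_derive x v f a -> is_derive x v (fun y => c * f y) (c * a).
Proof. exact: is_deriveZ. Qed.

Lemma is_derive_inv {R : realType} {V : normedModType R} (f : V -> R) x v a :
  f x != 0 -> is_derive x v f a ->
  is_derive x v (fun y => (f y)^-1) (- ((f x)^-1 ^+ 2 * a)).
Proof.
move=> fx [fa <-]; apply: DeriveDef; first exact: derivableV.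
by rewrite deriveV// scaleNr exprVn.
Qed.

(** Restriction to the line x + R v turns a directional derivative into an
    ordinary one, so that one-variable results such as the chain rule apply. *)
Lemma is_derive_line {R : realType} {V : normedModType R} (f : V -> R) x v t a :
  is_derive (x + t *: v) v f a <-> is_derive t 1 (fun s : R => f (x + s *: v)) a.
Proof.
have E : (fun h : R => h^-1 *: ((f \o shift (x + t *: v)) (h *: v) - f (x + t *: v)))
   = (fun h : R => h^-1 *: (((fun s : R => f (x + s *: v)) \o shift t) (h *: 1)
        - f (x + t *: v))).
  apply/funext => h /=.
  by rewrite [h%:A]mulr1 scalerDl addrCA.
by split=> -[d D]; apply: DeriveDef; [|rewrite -D| |rewrite -D];
  rewrite /derivable /derive E in d *.
Qed.

Lemma is_derive_comp {R : realType} {V : normedModType R} (f : V -> R) (h : R -> R)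
    x v a b :
  is_derive x v f a -> is_derive (f x) 1 h b ->
  is_derive x v (fun y => h (f y)) (b * a).
Proof.
have x0 : x = x + 0 *: v by rewrite scale0r addr0.
rewrite {1 3}x0 => /is_derive_line fa hb; apply/is_derive_line.
apply: (@is_derive1_comp _ h (fun s => f (x + s *: v))) => //.
by rewrite scale0r addr0.
Qed.

Lemma is_derive_big {R : realType} {V : normedModType R} n (f : 'I_n -> V -> R) x v a :
  (forall i, is_derive x v (f i) (a i)) ->
  is_derive x v (fun y => \sum_i f i y) (\sum_i a i).
Proof.
move=> fa; rewrite (_ : (fun y => _) = \sum_i f i); first exact: is_derive_sum.
by apply/funext => y; rewrite fct_sumE.
Qed.

Lemma is_derive_diff {R : realType} {V W : normedModType R} (f : V -> W) x v :
  differentiable f x -> is_derive x v f ('D_v f x).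
Proof. by move=> df; apply/derivableP/diff_derivable. Qed.

Lemma is_derive_coord {R : realType} {V : normedModType R} {n} (q : V -> 'rV[R]_n)
    x v a : is_derive x v q a <-> forall i, is_derive x v (fun y => q y 0 i) (a 0 i).
Proof.
split=> [[d <-] i|H].
  apply: DeriveDef; first by move/derivable_mxP : d.
  by rewrite derive_mx// mxE.
have d : derivable q x v.
  by apply/derivable_mxP => i j; rewrite ord1; case: (H j).
apply: DeriveDef => //; rewrite derive_mx//; apply/rowP => i; rewrite mxE.
by case: (H i).
Qed.

Lemma differentiable_rV {R : realType} {V : normedModType R} {n} (q : V -> 'rV[R]_n)
    x : (forall i, differentiable (fun y => q y 0 i) x) -> differentiable q x.
Proof.
move=> H; rewrite (_ : q = \sum_i (fun y => q y 0 i *: delta_mx 0 i)).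
  by apply: differentiable_sum => i; apply: differentiableZl; exact: H.
by apply/funext => y; rewrite fct_sumE {1}(row_sum_delta (q y)).
Qed.

Lemma differentiable_entry {R : realType} {V : normedModType R} {n} (q : V -> 'rV[R]_n)
    x i : differentiable q x -> differentiable (fun y => q y 0 i) x.
Proof.
by move=> dq; apply: (differentiable_comp dq (differentiable_coord (q x) 0 i)).
Qed.

Lemma differentiable_scale {R : realType} {V : normedModType R} {n} (c : V -> R)
    (q : V -> 'rV[R]_n) x : differentiable c x -> differentiable q x ->
  differentiable (fun y => c y *: q y) x.
Proof.
move=> dc dq; apply: differentiable_rV => i.
rewrite (_ : (fun y => _) = (fun y => c y * q y 0 i)); last by apply/funext => y; rewrite mxE.
by apply: differentiableM => //; apply: differentiable_entry.
Qed.

Lemma differentiable_dot {R : realType} {V : normedModType R} {n} (p q : V -> 'rV[R]_n)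
    x : differentiable p x -> differentiable q x ->
  differentiable (fun y => dot (p y) (q y)) x.
Proof.
move=> dp dq; rewrite (_ : (fun y => _) = \sum_i (fun y => p y 0 i * q y 0 i)).
  by apply: differentiable_sum => i; apply: differentiableM; apply: differentiable_entry.
by apply/funext => y; rewrite fct_sumE.
Qed.

Lemma is_derive_dot {R : realType} {V : normedModType R} {n} (p q : V -> 'rV[R]_n)
    x v a b : is_derive x v p a -> is_derive x v q b ->
  is_derive x v (fun y => dot (p y) (q y)) (dot a (q x) + dot (p x) b).
Proof.
move=> /is_derive_coord dp /is_derive_coord dq; rewrite /dot -big_split/=.
by apply: is_derive_big => i; apply: is_derive_mul.
Qed.

Lemma is_derive_scaler {R : realType} {V : normedModType R} {n} (c : V -> R)
    (q : V -> 'rV[R]_n) x v a b : is_derive x v c a -> is_derive x v q b ->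
  is_derive x v (fun y => c y *: q y) (a *: q x + c x *: b).
Proof.
move=> dc /is_derive_coord dq; apply/is_derive_coord => i; rewrite !mxE.
rewrite (_ : (fun y => _) = (fun y => c y * q y 0 i)); last by apply/funext => y; rewrite mxE.
exact: is_derive_mul.
Qed.

Lemma differentiable_real {R : realType} (h : R -> R) (s b : R) :
  is_derive s 1 h b -> differentiable h s.
Proof. by move=> [/derivable1_diffP]. Qed.

(** * Gradient fields and their divergence *)

(** If c were positive, df would be positive just to the right of its zero 0,
    and f would exceed f 0 there by the mean value theorem. *)
Lemma second_derivative_test {R : realType} (f df : R -> R) (r c : R) :
  0 < r -> (forall s : R, `|s| < r -> is_derive s 1 f (df s)) ->
  (forall s, `|s| < r -> f s <= f 0) -> is_derive (0 : R) 1 df c ->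
  df 0 = 0 /\ c <= 0.
Proof.
move=> r0 fdf fmax [ddf dc].
have df0 : df 0 = 0.
  have [_ <-] : is_derive (0 : R) 1 f (df 0) by apply: fdf; rewrite normr0.
  have [| | | |//] := @derive1_at_max _ f (- r) r 0.
  - by rewrite ge0_cp // ltW.
  - by move=> t; rewrite in_itv/= -ltr_norml => /fdf[].
  - by rewrite in_itv/= oppr_lt0 r0.
  - by move=> t; rewrite in_itv/= -ltr_norml => /fmax.
split=> //; rewrite leNgt; apply/negP => c0.
have : h^-1 *: (df (h *: 1 + 0) - df 0) @[h --> 0^'] --> c by rewrite -dc.
move=> /cvgr_gt /(_ 0 c0)[d /= d0 dP].
pose t := Num.min d r / 2.
have m0 : 0 < Num.min d r by rewrite lt_min d0 r0.
have t0 : 0 < t by rewrite divr_gt0.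
have tm : t < Num.min d r by rewrite ltr_pdivrMr// ltr_pMr// ltr1n.
have tr : t < r by rewrite (lt_le_trans tm)// ge_min lexx orbT.
have td : t < d by rewrite (lt_le_trans tm)// ge_min lexx.
have fder s : s \in `]0, t[%R -> is_derive s 1 f (df s).
  by rewrite in_itv/= => /andP[s0 st]; apply: fdf; rewrite gtr0_norm// (lt_trans st).
have fcont : {within `[0, t], continuous f}.
  apply: derivable_within_continuous => s; rewrite in_itv/= => /andP[s0 st].
  by have [] : is_derive s 1 f (df s) by apply: fdf; rewrite ger0_norm// (le_lt_trans st).
have [s] := MVT t0 fder fcont; rewrite in_itv/= => /andP[s0 st] E.
have := fmax t; rewrite gtr0_norm// => /(_ tr).
rewrite -subr_le0 E subr0 => /le_lt_trans/(_ (_ : 0 < _)).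
have := dP s; rewrite /= sub0r normrN gtr0_norm// (lt_trans st td) => /(_ isT).
rewrite gt_eqF// => /(_ isT); rewrite df0 subr0 addr0 [s%:A]mulr1 => sdf.
have : 0 < df s by rewrite -(pmulr_rgt0 _ (_ : 0 < s^-1)) ?invr_gt0.
by move=> /mulr_gt0/(_ t0) H /(_ _ H); rewrite ltxx.
Qed.

(** The gradient is carried along as an explicit field q, because formulas for
    it are only valid off the origin; second derivatives of W are then first
    derivatives of q. *)
Definition has_gradient {R : realType} {n} (W : 'rV[R]_n.+1 -> R)
    (q : 'rV[R]_n.+1 -> 'rV[R]_n.+1) : Prop :=
  forall y, y != 0 -> [/\ differentiable W y,
    forall v, is_derive y v W (dot (q y) v) & differentiable q y].

(** Applied to the gradient of a function homogeneous of degree 0, this is the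
    Laplacian of R^{n+1}, whose value on the unit sphere is the Laplace-Beltrami
    operator of the restriction: there is no radial contribution. *)
Definition divergence {R : realType} {n} (q : 'rV[R]_n.+1 -> 'rV[R]_n.+1)
    (x : 'rV[R]_n.+1) : R :=
  \sum_i dot ('D_(delta_mx 0 i) q x) (delta_mx 0 i).

Lemma divergenceD {R : realType} {n} (p q : 'rV[R]_n.+1 -> 'rV[R]_n.+1) x :
  differentiable p x -> differentiable q x ->
  divergence (fun y => p y + q y) x = divergence p x + divergence q x.
Proof.
move=> dp dq; rewrite /divergence -big_split/=; apply: eq_bigr => i _.
by rewrite deriveD ?dotDl//; apply: diff_derivable.
Qed.

Lemma divergence_scale {R : realType} {n} (c : 'rV[R]_n.+1 -> R)
    (q : 'rV[R]_n.+1 -> 'rV[R]_n.+1) g x :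
  (forall v, is_derive x v c (dot g v)) -> differentiable q x ->
  divergence (fun y => c y *: q y) x = dot g (q x) + c x * divergence q x.
Proof.
move=> dc dq; rewrite /divergence dot_sum_delta mulr_sumr -big_split/=.
apply: eq_bigr => i _.
have [_ ->] := is_derive_scaler (dc (delta_mx 0 i))
  (is_derive_diff (delta_mx 0 i) dq).
by rewrite dotDl !dotZl dot_delta mulrC.
Qed.

Lemma has_gradientD {R : realType} {n} (W1 W2 : 'rV[R]_n.+1 -> R) q1 q2 :
  has_gradient W1 q1 -> has_gradient W2 q2 ->
  has_gradient (fun y => W1 y + W2 y) (fun y => q1 y + q2 y).
Proof.
move=> h1 h2 y y0; have [a1 b1 c1] := h1 y y0; have [a2 b2 c2] := h2 y y0.
split=> [|v|]; [exact: differentiableD| |exact: differentiableD].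
by rewrite dotDl; apply: is_derive_add.
Qed.

Lemma has_gradient_comp {R : realType} {n} (W : 'rV[R]_n.+1 -> R) q (h dh : R -> R) :
  (forall y, y != 0 -> is_derive (W y) 1 h (dh (W y))) ->
  (forall y, y != 0 -> differentiable dh (W y)) ->
  has_gradient W q ->
  has_gradient (fun y => h (W y)) (fun y => dh (W y) *: q y).
Proof.
move=> hd dhd hW y y0; have [a b c] := hW y y0; split=> [|v|].
- by apply: (differentiable_comp a); apply: differentiable_real (hd _ y0).
- by rewrite dotZl; apply: is_derive_comp => //; apply: hd.
- apply: differentiable_scale => //.
  by apply: (differentiable_comp a); apply: dhd.
Qed.

Lemma has_gradientZ {R : realType} {n} c (W : 'rV[R]_n.+1 -> R) q :
  has_gradient W q -> has_gradient (fun y => c * W y) (fun y => c *: q y).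
Proof.
move=> hW; apply: (@has_gradient_comp _ _ W q (fun s => c * s) (fun=> c)) => // y y0.
by have := is_derive_scale c (is_derive_id (W y) 1); rewrite mulr1.
Qed.

(** The second derivative test along every line through x. A global maximum is
    enough here, since a function homogeneous of degree 0 that is maximal at x
    on the sphere is maximal at x on the whole punctured space. *)
Lemma max_gradient0 {R : realType} {n} (W : 'rV[R]_n.+1 -> R) q x :
  has_gradient W q -> x != 0 -> (forall y, y != 0 -> W y <= W x) ->
  q x = 0 /\ divergence q x <= 0.
Proof.
move=> hW x0 Wmax.
have [_ _ dq] := hW x x0.
suff H v : dot (q x) v = 0 /\ dot ('D_v q x) v <= 0.
  split; last by apply: sumr_le0 => i _; have [] := H (delta_mx 0 i).
  by apply/eqP; rewrite -dot_eq0; have [/eqP] := H (q x).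
have [r r0 rP] : exists2 r : R, 0 < r & forall s, `|s| < r -> x + s *: v != 0.
  have [v0|v0] := eqVneq v 0.
    by exists 1 => // s _; rewrite v0 scaler0 addr0.
  exists (`|x| / `|v|); first by rewrite divr_gt0 ?normr_gt0.
  move=> s; rewrite ltr_pdivlMr ?normr_gt0// => sv; apply/eqP => /eqP.
  rewrite addr_eq0 => /eqP xE; move: sv.
  by rewrite xE normrN normrZ ltxx.
have := @second_derivative_test _ (fun s => W (x + s *: v))
  (fun s => dot (q (x + s *: v)) v) r (dot ('D_v q x) v) r0.
rewrite scale0r addr0; apply.
- by move=> s /rP xs; apply/(is_derive_line W); have [_ dW _] := hW _ xs; exact: dW.
- by move=> s /rP xs; apply: Wmax.
- apply/(is_derive_line (fun y => dot (q y) v)); rewrite scale0r addr0.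
  have := is_derive_dot (is_derive_diff v dq) (is_derive_cst v x v).
  by rewrite dot0r addr0.
Qed.

(** * The latitude function *)

Lemma has_gradientM {R : realType} {n} (W1 W2 : 'rV[R]_n.+1 -> R) q1 q2 :
  has_gradient W1 q1 -> has_gradient W2 q2 ->
  has_gradient (fun y => W1 y * W2 y) (fun y => W2 y *: q1 y + W1 y *: q2 y).
Proof.
move=> h1 h2 y y0; have [a1 b1 c1] := h1 y y0; have [a2 b2 c2] := h2 y y0.
split=> [|v|]; [exact: differentiableM| |].
  by rewrite dotDl !dotZl mulrC; apply: is_derive_mul.
by apply: differentiableD; apply: differentiable_scale.
Qed.

Lemma has_gradient_linear {R : realType} {n} (p : 'rV[R]_n.+1) :
  has_gradient (fun y => dot y p) (fun=> p).
Proof.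
move=> y y0; have dp : differentiable (fun=> p : 'rV[R]_n.+1) y by exact: differentiable_cst.
split=> // [|v].
  by apply: differentiable_dot => //; apply/diff_derivable.
have := is_derive_dot (is_derive_id y v) (is_derive_cst p y v).
by rewrite dot0r addr0 dotC.
Qed.

Lemma has_gradient_dot {R : realType} {n} :
  has_gradient (fun y : 'rV[R]_n.+1 => dot y y) (fun y => 2 *: y).
Proof.
move=> y y0; split=> [|v|].
- by apply: differentiable_dot.
- have := is_derive_dot (is_derive_id y v) (is_derive_id y v).
  by rewrite dotZl (dotC v y) /= -mulr2n mulr_natl.
- exact: (@differentiable_scale _ _ _ (fun=> 2) id).
Qed.

Lemma has_gradient_inv_enorm {R : realType} {n} :
  has_gradient (fun y : 'rV[R]_n.+1 => (enorm y)^-1)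
               (fun y => - (enorm y)^-1 ^+ 3 *: y).
Proof.
pose dh (s : R) := - (Num.sqrt s)^-1 ^+ 3 / 2.
have hd (s : R) : 0 < s -> is_derive s 1 (fun s : R => (Num.sqrt s)^-1) (dh s).
  move=> s0; have [|d D] := @is_derive_inv _ R^o Num.sqrt s 1 _ _ (is_derive1_sqrt s0).
    by rewrite gt_eqF// sqrtr_gt0.
  apply: DeriveDef => //; rewrite D /dh invfM; ring.
have dd (s : R) : 0 < s -> differentiable dh s.
  move=> s0; have ds := differentiable_real (hd s s0).
  pose r (t : R) := (Num.sqrt t)^-1.
  rewrite (_ : dh = (fun=> - 2^-1) * (r * (r * r))); last first.
    by apply/funext => t; rewrite /dh !fctE /r !exprS expr0; ring.
  apply: differentiableM; first exact: differentiable_cst.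
  by apply: differentiableM => //; apply: differentiableM.
have := @has_gradient_comp R n _ _ (fun s : R => (Num.sqrt s)^-1) dh _ _ has_gradient_dot.
rewrite (_ : (fun y : 'rV[R]_n.+1 => dh (dot y y) *: (2 *: y)) =
  (fun y => - (enorm y)^-1 ^+ 3 *: y)).
  by apply=> y y0; [apply: hd|apply: dd]; rewrite dot_gt0.
apply/funext => y; rewrite scalerA /dh divfK// ?pnatr_eq0//.
Qed.

(** The height function <x,p> of the sphere, extended with degree 0. *)
Definition latitude {R : realType} {n} (p y : 'rV[R]_n.+1) : R := dot y p * (enorm y)^-1.

Definition latitude_grad {R : realType} {n} (p y : 'rV[R]_n.+1) : 'rV[R]_n.+1 :=
  (enorm y)^-1 *: p + dot y p *: (- (enorm y)^-1 ^+ 3 *: y).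

Lemma has_gradient_latitude {R : realType} {n} (p : 'rV[R]_n.+1) :
  has_gradient (latitude p) (latitude_grad p).
Proof. exact: has_gradientM (has_gradient_linear p) has_gradient_inv_enorm. Qed.

Lemma divergence_id {R : realType} {n} (x : 'rV[R]_n.+1) : divergence id x = n.+1%:R.
Proof.
rewrite /divergence (eq_bigr (fun=> 1)) => [|i _]; last first.
  by rewrite derive_id dot_delta mxE !eqxx.
by rewrite sumr_const card_ord.
Qed.

Lemma divergence_cst {R : realType} {n} (p x : 'rV[R]_n.+1) :
  divergence (fun=> p) x = 0.
Proof. by rewrite /divergence big1// => i _; rewrite derive_cst dot0l. Qed.

(** Heights are spherical harmonics of degree 1, with eigenvalue n. *)
Lemma divergence_latitude {R : realType} {n} (p x : 'rV[R]_n.+1) : sphere x ->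
  divergence (latitude_grad p) x = - n%:R * dot x p.
Proof.
move=> xS; have x0 := sphere_neq0 xS.
have [dN gN dgN] := @has_gradient_inv_enorm R n x x0.
have [dT gT dgT] := @has_gradient_linear R n p x x0.
have x1 : (enorm x)^-1 = 1 by rewrite xS invr1.
rewrite divergenceD; last 2 first.
- by apply: differentiable_scale.
- by apply: differentiable_scale.
rewrite (divergence_scale gN dgT) divergence_cst mulr0 addr0.
rewrite (divergence_scale gT dgN).
pose N := fun y : 'rV[R]_n.+1 => (enorm y)^-1.
have g3 v : is_derive x v (fun y => - N y ^+ 3) (dot (3 *: x) v).
  have -> : (fun y => - N y ^+ 3) = (fun y => - (N y * (N y * N y))).
    by apply/funext => y; rewrite !exprS expr0 mulr1.
  have h := is_derive_opp (is_derive_mul (gN v) (is_derive_mul (gN v) (gN v))).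
  apply: is_derive_eq h _.
  by rewrite x1 !dotZl; ring.
rewrite (divergence_scale g3 (_ : differentiable id x))//.
rewrite divergence_id x1 !dotZl !dotZr.
rewrite (_ : dot x x = 1); last exact/sphereE.
by rewrite (dotC p x) -[n.+1%:R]natr1 /N x1; ring.
Qed.

(** * Compactness of the sphere *)

Lemma enorm_continuous {R : realType} {n} : continuous (@enorm R n.+1).
Proof.
move=> y; apply: (@continuous_comp _ _ _ (fun z : 'rV[R]_n.+1 => dot z z) Num.sqrt).
  by apply: differentiable_continuous; apply: differentiable_dot.
exact: sqrt_continuous.
Qed.

Lemma sphere_closed {R : realType} {n} : closed (@sphere R n).
Proof.
apply: (@preimage_closed _ _ (@enorm R n.+1) [set 1]).
  by move=> y _; exact: enorm_continuous.
exact: closed_eq.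
Qed.

Lemma sphere_compact {R : realType} {n} : compact (@sphere R n).
Proof.
apply: bounded_closed_compact; last exact: sphere_closed.
exists 1; split; first exact: num_real.
move=> M M1 x xS; rewrite /Num.Def.normr/= mx_normrE.
apply: (@bigmax_le _ _ _ _ _ _ M) => [|[i j] _]; first by rewrite (le_trans _ (ltW M1)).
rewrite ord1 /= (le_trans _ (ltW M1))//.
have := cauchy_schwarz x (delta_mx 0 j); rewrite dot_delta xS mul1r => /le_trans; apply.
by rewrite /enorm dot_delta mxE !eqxx sqrtr1.
Qed.

Lemma sphere_preimage_compact {R : realType} {n} (f : 'rV[R]_n.+1 -> R) (D : set R) :
  (forall x, sphere x -> {for x, continuous f}) -> closed D ->
  compact (@sphere R n `&` f @^-1` D).
Proof.
move=> fc cD; apply: (subclosed_compact _ sphere_compact); last by move=> x [].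
move=> x xcl.
have xS : sphere x by apply: sphere_closed; apply: closure_subset xcl => z [].
split=> //; apply: contrapT => fxD.
have /fc fcx := xS.
have nD : nbhs (f x) (~` D).
  by apply: open_nbhs_nbhs; split=> //; exact: closed_openC.
by have [z [[_ zD]]] := xcl _ (fcx _ nD).
Qed.

Lemma compact_sphere_max {R : realType} {n} (f : 'rV[R]_n.+1 -> R) (A : set 'rV[R]_n.+1) :
  A `<=` @sphere R n -> compact A -> A !=set0 ->
  (forall x, sphere x -> {for x, continuous f}) ->
  exists2 c, A c & forall x, A x -> f x <= f c.
Proof.
move=> AS cA A0 fc; have [|c] := EVT_max_rV A0 cA (_ : {within A, continuous f}).
  apply: continuous_in_subspaceT => x /set_mem/AS; exact: fc.
rewrite inE => Ac cmax; exists c => // x Ax.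
by apply: cmax; rewrite inE.
Qed.

Lemma latitude_le1 {R : realType} {n} (x p : 'rV[R]_n.+1) :
  sphere x -> sphere p -> -1 <= dot x p <= 1.
Proof.
by move=> xS pS; rewrite -ler_norml (le_trans (cauchy_schwarz _ _))// xS pS mulr1.
Qed.

Lemma latitude_eq1 {R : realType} {n} (x p : 'rV[R]_n.+1) :
  sphere x -> sphere p -> dot x p = 1 -> x = p.
Proof.
move=> /sphereE xx /sphereE pp xp; apply/eqP; rewrite -subr_eq0 -dot_eq0.
by rewrite !dotE (dotC p x) xx pp xp; apply/eqP; ring.
Qed.

(** Turn the first two coordinates of p by a right angle and drop the others.
    On the 0-sphere, a pair of antipodal points, no such z exists and the strong
    maximum principle fails. *)
Lemma exists_orthogonal {R : realType} {n} (p : 'rV[R]_n.+1) : (1 <= n)%N ->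
  sphere p -> exists2 z, sphere z & dot z p = 0.
Proof.
move=> n1 /sphereE pp.
pose i0 : 'I_n.+1 := ord0; pose i1 : 'I_n.+1 := Ordinal (n1 : 1 < n.+1)%N.
pose z : 'rV[R]_n.+1 := p 0 i1 *: delta_mx 0 i0 - p 0 i0 *: delta_mx 0 i1.
have zp : dot z p = 0.
  by rewrite !dotE !(dotC _ p) !dot_delta; ring.
have [z0|z0] := eqVneq z 0; last first.
  exists (unitize z); first exact: unitize_sphere.
  by rewrite /unitize dotZl zp mulr0.
(* If the two coordinates vanish, any vector of their plane is orthogonal to p. *)
exists (delta_mx 0 i0); first by apply/sphereE; rewrite dot_delta mxE !eqxx.
move/rowP : z0 => /(_ i1); rewrite !mxE !eqxx /= mulr0 mulr1 add0r.
by rewrite dotC dot_delta => /eqP; rewrite oppr_eq0 => /eqP.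
Qed.

(** * The strong maximum principle on the sphere *)

(** The exponential makes the second order term of the Laplacian dominate for
    large a: it grows like a^2, everything else like a. *)
Definition barrier {R : realType} {n} (a : R) (p y : 'rV[R]_n.+1) : R :=
  expR (a * latitude p y).

Definition barrier_grad {R : realType} {n} (a : R) (p y : 'rV[R]_n.+1) :
  'rV[R]_n.+1 := (a * barrier a p y) *: latitude_grad p y.

Lemma has_gradient_barrier {R : realType} {n} a (p : 'rV[R]_n.+1) :
  has_gradient (barrier a p) (barrier_grad a p).
Proof.
have hd (s : R) : is_derive s 1 (fun s => expR (a * s)) (a * expR (a * s)).
  have := is_derive_comp (is_derive_scale a (is_derive_id s 1)) (is_derive_expR (a * s)).
  by rewrite mulr1 mulrC.
exact: (@has_gradient_comp _ _ (latitude p) _ _ (fun s => a * expR (a * s))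
  (fun y _ => hd _) (fun y _ => differentiable_real (is_derive_scale a (hd _)))
  (has_gradient_latitude p)).
Qed.

Lemma latitude_sphere {R : realType} {n} (p x : 'rV[R]_n.+1) : sphere x ->
  latitude p x = dot x p.
Proof. by move=> xS; rewrite /latitude xS invr1 mulr1. Qed.

Lemma latitude_grad_sqr {R : realType} {n} (p x : 'rV[R]_n.+1) :
  sphere x -> sphere p ->
  dot (latitude_grad p x) (latitude_grad p x) = 1 - dot x p ^+ 2.
Proof.
move=> xS /sphereE pp; rewrite /latitude_grad xS invr1 scale1r expr1n.
move/sphereE : xS => xx.
by rewrite !dotE xx pp (dotC p x); ring.
Qed.

Lemma divergence_barrier {R : realType} {n} a (p x : 'rV[R]_n.+1) :
  sphere x -> sphere p ->
  divergence (barrier_grad a p) x =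
    barrier a p x * (a ^+ 2 * (1 - dot x p ^+ 2) - a * n%:R * dot x p).
Proof.
move=> xS pS; have x0 := sphere_neq0 xS.
have [_ _ dT] := has_gradient_latitude p x0.
have [_ gH _] := has_gradient_barrier a p x0.
have gaH v : is_derive x v (fun y => a * barrier a p y)
    (dot (a *: barrier_grad a p x) v) by rewrite dotZl; apply: is_derive_scale.
rewrite (divergence_scale gaH dT) divergence_latitude// !dotZl.
rewrite latitude_grad_sqr//; ring.
Qed.

(** Hopf's argument in a global form. Suppose that the contact set Z = {W = M}
    is not the whole sphere, and consider a cap around a pole p which avoids Z
    and whose rim touches Z. Add to W a small multiple e of the barrier
    exp (a <x,p>). Below the rim the barrier is lower than on the rim, and deep
    inside the cap W is below M by a fixed amount, so the maximum of the sum is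
    attained at a latitude in between. There the gradient of W is minus that of
    the barrier and the Laplacian of W is at most minus that of the barrier,
    while both M - W and the gradient of W are of the order of e: for a large,
    this contradicts the differential inequality.

    The norm of the gradient on the right-hand side makes the hypothesis directly
    applicable to differences of solutions of a quasilinear equation: no linear
    equation for W has to be derived. *)
Lemma strong_maximum {R : realType} {n} (W : 'rV[R]_n.+1 -> R) q (M eta C B : R) :
  (1 <= n)%N -> has_gradient W q -> (forall y, W (unitize y) = W y) ->
  0 < eta -> 0 <= C -> 0 <= B ->
  (forall x, sphere x -> W x <= M) ->
  (forall x, sphere x -> M - eta < W x ->
    - C * (M - W x) - B * enorm (q x) <= divergence q x) ->
  (exists2 x, sphere x & W x = M) ->
  forall x, sphere x -> W x = M.
Proof.
move=> n1 hW Wu eta0 C0 B0 WM Wineq [x0 x0S Wx0] y yS; apply: contrapT => Wy.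
(* Let Z be the contact set W = M. The pole p lies outside Z, and Z has a
   point x1 other than -p: the largest cap around p that avoids Z then stays
   away from -p, where the gradient of the latitude vanishes. *)
have [p [x1 [pS x1S Wp Wx1 x1p]]] : exists p x1, [/\ sphere p, sphere x1,
    W p <> M, W x1 = M & -1 < dot x1 p].
  have [xy|xy] := ltP (-1) (dot x0 y); first by exists y, x0.
  have [z zS zy] := exists_orthogonal n1 yS.
  have [Wz|Wz] := pselect (W z = M); first by exists y, z; rewrite zy ltrN10.
  exists z, x0; split=> //.
  have -> : x0 = - y.
    apply: latitude_eq1 => //; first by rewrite /sphere/= -scaleN1r enormZ normrN1 mul1r.
    rewrite dotNr; have /andP[] := latitude_le1 x0S yS; lra.
  by rewrite dotNl dotC zy oppr0 ltrN10.
have Wc x : sphere x -> {for x, continuous W}.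
  by move=> /sphere_neq0 /hW[/differentiable_continuous].
have tc x : sphere x -> {for x, continuous (fun y => dot y p)}.
  by move=> /sphere_neq0 /(has_gradient_linear p)[/differentiable_continuous].
(* The open cap of latitude above t1 avoids Z, and its rim touches Z at x2. *)
have [x2 [x2S Wx2] x2max] : exists2 c, (@sphere R n `&` W @^-1` [set M]) c &
    forall x, (@sphere R n `&` W @^-1` [set M]) x -> dot x p <= dot c p.
  apply: compact_sphere_max; [by move=> x []| | |done].
  - exact: sphere_preimage_compact.
  - by exists x1.
set t1 := dot x2 p in x2max.
have t1gt : -1 < t1 by apply: lt_le_trans x1p _; apply: x2max.
have t1lt : t1 < 1.
  rewrite lt_neqAle; have /andP[_ ->] := latitude_le1 x2S pS; rewrite andbT.
  by apply/eqP => /(latitude_eq1 x2S pS) E; apply: Wp; rewrite -E.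
pose t2 := (1 + t1) / 2.
have [m [m0 mP]] : exists m, 0 < m /\
    forall x, sphere x -> t2 <= dot x p -> W x <= M - m.
  have [c [cS ct] cmax] : exists2 c, (@sphere R n `&` (fun x => dot x p) @^-1` [set t | t2 <= t]) c &
      forall x, (@sphere R n `&` (fun x => dot x p) @^-1` [set t | t2 <= t]) x -> W x <= W c.
    apply: compact_sphere_max; [by move=> x []| | |done].
    - exact: sphere_preimage_compact.
    - exists p; split => //=; move/sphereE : pS => ->; rewrite /t2; lra.
  exists (M - W c); split=> [|x xS xt]; last by rewrite opprB addrC subrK; exact: cmax.
  rewrite subr_gt0 lt_neqAle WM// andbT; apply/eqP => WcM.
  have := x2max c (conj cS WcM); move: ct; rewrite /= /t2; lra.
(* Between the latitudes t1 and t2 the squared gradient 1 - t^2 of the latitude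
   is at least d; a is chosen for the last inequality of the proof. *)
pose d := (1 - t1) / 2 * (1 + t1).
have d0 : 0 < d by rewrite /d mulr_gt0; lra.
have d1 : d <= 1 by rewrite /d; nra.
pose a := (n%:R + B + C + 1) / d.
have n0 : 0 <= n%:R :> R by rewrite ler0n.
have a1 : 1 <= a by rewrite /a ler_pdivlMr// mul1r; lra.
have a0 : 0 < a by rewrite (lt_le_trans ltr01).
have ad : a * d = n%:R + B + C + 1 by rewrite /a divfK// gt_eqF.
(* The perturbation e * barrier is smaller than the gap m above latitude t2 and
   smaller than eta, so it cannot leave the region where the inequality holds. *)
pose mu := Num.min m eta.
have mu0 : 0 < mu by rewrite lt_min m0.
pose e := mu / (2 * expR a).
have e0 : 0 < e by rewrite divr_gt0// mulr_gt0// expR_gt0.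
have ea : e * expR a < mu.
  rewrite /e invfM mulrA divfK ?gt_eqF ?expR_gt0//; lra.
have [em eeta] : e * expR a < m /\ e * expR a < eta.
  by split; apply: lt_le_trans ea _; rewrite ge_min lexx ?orbT.
pose F y := W y + e * barrier a p y.
have hF : has_gradient F (fun y => q y + e *: barrier_grad a p y).
  exact: (has_gradientD hW (has_gradientZ e (has_gradient_barrier a p))).
have Fu z : z != 0 -> F (unitize z) = F z.
  move=> z0; rewrite /F Wu /barrier latitude_sphere; last exact: unitize_sphere.
  by rewrite /latitude /unitize dotZl (mulrC (enorm z)^-1).
have [x xS xmax] : exists2 c, @sphere R n c & forall x, sphere x -> F x <= F c.
  apply: compact_sphere_max; [by []|exact: sphere_compact|by exists p|].
  by move=> z /sphere_neq0 /hF[/differentiable_continuous].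
(* First and second order conditions at the maximum x of W + e * barrier. *)
have [qF dF] : q x + e *: barrier_grad a p x = 0 /\
    divergence (fun y => q y + e *: barrier_grad a p y) x <= 0.
  apply: (max_gradient0 hF (sphere_neq0 xS)) => z z0.
  by rewrite -Fu//; apply: xmax; exact: unitize_sphere.
have bE z : sphere z -> barrier a p z = expR (a * dot z p).
  by move=> zS; rewrite /barrier latitude_sphere.
have := xmax x2 x2S; rewrite /F Wx2 !bE// -/t1 => Fx.
set t := dot x p in Fx.
set H := expR (a * t) in Fx; set H1 := expR (a * t1) in Fx.
have [tm1 t_le1] : -1 <= t /\ t <= 1 by apply/andP/latitude_le1.
have H0 : 0 < H by exact: expR_gt0.
have H10 : 0 < H1 by exact: expR_gt0.
have Ha : H <= expR a by rewrite ler_expR ler_piMr// ltW.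
have eH : e * H <= e * expR a by rewrite ler_pM2l.
have eH1 : 0 < e * H1 by rewrite mulr_gt0.
have t1t : t1 <= t.
  rewrite leNgt; apply/negP => tt1.
  have : H < H1 by rewrite ltr_expR ltr_pM2l.
  rewrite -(ltr_pM2l e0); move: (WM x xS) Fx; clear; lra.
have tt2 : t < t2.
  by rewrite ltNge; apply/negP => /(mP x xS); move: Fx eH eH1 em; clear; lra.
have Weta : M - eta < W x by move: Fx eH eH1 eeta; clear; lra.
have dt : d <= 1 - t ^+ 2.
  by rewrite /d /t2 in tt2 *; move: tt2 t1t t1gt t1lt; clear; nra.
have dq : divergence q x = divergence (fun y => q y + e *: barrier_grad a p y) x
    - e * divergence (barrier_grad a p) x.
  have [_ _ dqx] := hW x (sphere_neq0 xS).
  have [_ _ dbx] := has_gradient_barrier a p (sphere_neq0 xS).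
  rewrite divergenceD//; last by apply: differentiable_scale.
  have e' v : is_derive x v (fun=> e) (dot 0 v) by rewrite dot0l; exact: is_derive_cst.
  by rewrite (divergence_scale e' dbx) dot0l add0r addrK.
have nq : enorm (q x) <= e * (a * H).
  have -> : q x = - (e * (a * H)) *: latitude_grad p x.
    by move/eqP : qF; rewrite addr_eq0 => /eqP ->; rewrite /barrier_grad bE// scalerA scaleNr.
  have eaH0 : 0 <= e * (a * H).
    by rewrite mulr_ge0 ?(ltW e0)// mulr_ge0 ?(ltW a0)// ltW.
  rewrite enormZ normrN ger0_norm// ler_piMr//.
  rewrite -(expr_le1 (n := 2))// ?enorm_ge0// enorm_sqr latitude_grad_sqr//.
  by rewrite gerBl sqr_ge0.
have := Wineq x xS Weta; rewrite dq divergence_barrier// bE// -/t -/H.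
set X := a ^+ 2 * _ - _.
have K0 : 0 < e * H by rewrite mulr_gt0.
(* e * H * X is e times the Laplacian of the barrier at x. *)
have XL : C + B * a < X.
  have aa : a * (n%:R + B + C + 1) <= a ^+ 2 * (1 - t ^+ 2).
    by rewrite -ad mulrA -expr2 ler_wpM2l// sqr_ge0.
  have ant : a * n%:R * t <= a * n%:R.
    by rewrite ler_piMr// mulr_ge0// ltW.
  by rewrite /X; move: aa ant a1 C0; clear; nra.
have BN : B * enorm (q x) <= B * (e * H * a).
  by apply: ler_wpM2l => //; move: nq; rewrite (mulrC a) mulrA.
have CN : C * (M - W x) <= C * (e * H).
  by apply: ler_wpM2l => //; move: Fx eH1; clear; lra.
have XK : e * H * (C + B * a) < e * H * X by rewrite ltr_pM2l.
by rewrite (mulrA e H X); move: BN CN XK dF; clear; lra.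
Qed.

(** * Traces in a tangent frame *)

Lemma dot_mx {R : realType} {n} (u v : 'rV[R]_n) : dot u v = (u *m v^T) 0 0.
Proof. by rewrite mxE; apply: eq_bigr => i _; rewrite mxE. Qed.

Lemma metric_mxE {R : realType} {n} (E : 'M[R]_(n, n.+1)) : metric_mx E = E *m E^T.
Proof.
apply/matrixP => i j; rewrite !mxE; apply: eq_bigr => k _.
by rewrite !mxE.
Qed.

Lemma metric_mx_unit {R : realType} {n} (E : 'M[R]_(n, n.+1)) :
  row_free E -> metric_mx E \in unitmx.
Proof.
move=> freeE; rewrite -row_free_unit; apply: inj_row_free => v.
rewrite metric_mxE => vEE; apply/eqP; rewrite -(mulmx_free_eq0 v freeE) -dot_eq0 dot_mx.
by rewrite trmx_mul mulmxA -(mulmxA v) vEE mul0mx mxE.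
Qed.

(** The orthogonal projection onto the tangent space, written in a frame that
    need not be orthonormal. Stacking x on top of E gives an invertible matrix,
    and the formula says that its explicit right inverse is a left inverse. *)
Lemma tangent_projection {R : realType} {n} (x : 'rV[R]_n.+1) (E : 'M[R]_(n, n.+1)) :
  sphere x -> tangent_frame x E ->
  E^T *m invmx (metric_mx E) *m E = 1%:M - x^T *m x.
Proof.
move=> /sphereE xx [freeE Ex].
have Ext : E *m x^T = 0.
  by apply/colP => i; have := Ex i; rewrite dot_mx -row_mul mxE => ->; rewrite mxE.
have xEt : x *m E^T = 0 by apply: trmx_inj; rewrite trmx_mul trmxK Ext trmx0.
have QS : col_mx x E *m row_mx x^T (E^T *m invmx (metric_mx E)) = 1%:M.
  rewrite mul_col_row !mulmxA xEt mul0mx Ext -metric_mxE.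
  rewrite mulmxV ?metric_mx_unit// (_ : x *m x^T = 1%:M) -?scalar_mx_block//.
  by apply/matrixP => i j; rewrite !ord1 -dot_mx xx mxE eqxx.
have SQ : row_mx x^T (E^T *m invmx (metric_mx E)) *m col_mx x E = 1%:M.
  exact: (@mulmx1C R n.+1 _ _ QS).
by rewrite -SQ mul_row_col addrC addKr.
Qed.

(** The trace of a tangential operator does not depend on the frame: it is the
    trace of the ambient operator minus its radial part. *)
Lemma frame_trace {R : realType} {n} (x : 'rV[R]_n.+1) (E : 'M[R]_(n, n.+1))
    (A : 'M[R]_n.+1) : sphere x -> tangent_frame x E ->
  \tr (invmx (metric_mx E) *m (E *m A *m E^T)) = \tr A - (x *m A *m x^T) 0 0.
Proof.
move=> xS xE.
have -> : (x *m A *m x^T) 0 0 = \tr (A *m (x^T *m x)).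
  by rewrite mulmxA mxtrace_mulC mulmxA /mxtrace big_ord1.
rewrite mxtrace_mulC -!mulmxA mxtrace_mulC -mulmxA.
by rewrite (tangent_projection xS xE) mulmxBr mulmx1 raddfB.
Qed.

Lemma S1_trace {R : realType} {n} (lam : 'I_n -> R) (B : 'M[R]_n) : (1 <= n)%N ->
  char_poly B = \prod_(i < n) ('X - (lam i)%:P) -> S1 lam = \tr B.
Proof.
move=> n1 BE; have := char_poly_trace B n1; rewrite BE.
have := @coefPn_prod_XsubC R (map lam (enum 'I_n)).
rewrite size_map size_enum_ord -lt0n => /(_ n1).
by rewrite !big_map -[Finite.enum _]/(index_enum _) => -> /oppr_inj.
Qed.

(** * The logarithm of the radial function *)

Lemma near_neq0 {R : realType} {n} (x : 'rV[R]_n.+1) : x != 0 -> \forall y \near x, y != 0.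
Proof.
rewrite -enorm_gt0 => x0.
have /cvgr_gt/(_ 0 x0) := @enorm_continuous R n x.
by apply: filterS => y; rewrite enorm_gt0.
Qed.

(** Partial derivatives assemble into a gradient by linearity of the
    differential. *)
Lemma Ck2_has_gradient {R : realType} {n} (F : 'rV[R]_n.+1 -> R) :
  Ck 2 [set y | y != 0] F ->
  has_gradient F (fun y => \row_i 'D_(delta_mx 0 i) F y).
Proof.
move=> [dF ddF] y y0; split=> [|v|]; first exact: dF.
- apply: is_derive_eq (is_derive_diff v (dF y y0)) _.
  rewrite deriveE; last exact: dF.
  rewrite {1}(row_sum_delta v) linear_sum dot_sum_delta; apply: eq_bigr => i _.
  by rewrite linearZ dot_delta mxE deriveE//; exact: dF.
- apply: differentiable_rV => i.
  rewrite (_ : (fun z => _) = 'D_(delta_mx 0 i) F); last by apply/funext => z; rewrite mxE.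
  by have [+ _] := ddF (delta_mx 0 i); exact.
Qed.

(** In terms of v = - ln rho the equation contains v itself only through g, and
    homotheties of the hypersurface become additive constants. *)
Definition nlog_radial {R : realType} {n} (rho : 'rV[R]_n.+1 -> R) y : R :=
  - ln (rho (unitize y)).

Definition nlog_radial_grad {R : realType} {n} (rho : 'rV[R]_n.+1 -> R) y :
  'rV[R]_n.+1 :=
  - (rho (unitize y))^-1 *: \row_i 'D_(delta_mx 0 i) (rho \o @unitize R n.+1) y.

Lemma has_gradient_nlog_radial {R : realType} {n} (rho : 'rV[R]_n.+1 -> R) :
  Ck_sphere 2 rho -> (forall x, sphere x -> 0 < rho x) ->
  has_gradient (nlog_radial rho) (nlog_radial_grad rho).
Proof.
move=> /Ck2_has_gradient hF rho0.
have hd (s : R) : 0 < s -> is_derive s 1 (fun s : R => - ln s) (- s^-1).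
  by move=> s0; apply: is_derive_opp; exact: is_derive1_ln.
have dd (s : R) : 0 < s -> differentiable (fun s : R => - s^-1) s.
  move=> s0; apply: differentiableN; apply: differentiable_Rinv.
  by rewrite gt_eqF.
have Fpos y : y != 0 -> 0 < rho (unitize y) by move=> /unitize_sphere/rho0.
exact: (has_gradient_comp (fun y y0 => hd _ (Fpos y y0)) (fun y y0 => dd _ (Fpos y y0)) hF).
Qed.

Lemma unitize_idem {R : realType} {n} (y : 'rV[R]_n.+1) :
  unitize (unitize y) = unitize y.
Proof.
have [->|y0] := eqVneq y 0; first by rewrite /unitize !scaler0.
exact/unitize_id/unitize_sphere.
Qed.

(** W is constant on rays. *)
Lemma radial_gradient0 {R : realType} {n} (W : 'rV[R]_n.+1 -> R) q y :
  has_gradient W q -> (forall z, W (unitize z) = W z) -> y != 0 -> dot (q y) y = 0.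
Proof.
move=> hW Wu y0; have [_ dW _] := hW y y0.
have : is_derive (y + 0 *: y) y W (dot (q y) y) by rewrite scale0r addr0; exact: dW.
move=> /(is_derive_line W)[_ <-].
rewrite (@near_eq_derive _ _ _ _ (cst (W y))) ?derive_cst//.
have := @nbhs0_lt _ R 1 ltr01; apply: filterS => s /ltr_normlP[s1 s2].
rewrite /= -Wu -[RHS]Wu -{1}[y]scale1r -scalerDl unitizeZ//.
by move: s1 s2; clear; lra.
Qed.

Lemma is_derive_unitize {R : realType} {n} (x v : 'rV[R]_n.+1) :
  sphere x -> dot v x = 0 -> is_derive x v (@unitize R n.+1) v.
Proof.
move=> xS vx; have [_ dN _] := @has_gradient_inv_enorm R n x (sphere_neq0 xS).
have := is_derive_scaler (dN v) (is_derive_id x v).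
by rewrite dotZl dotC vx mulr0 scale0r add0r xS invr1 scale1r.
Qed.

Lemma differentiable_unitize {R : realType} {n} (x : 'rV[R]_n.+1) :
  x != 0 -> differentiable (@unitize R n.+1) x.
Proof.
move=> x0; have [dN _ _] := @has_gradient_inv_enorm R n x x0.
exact: (@differentiable_scale _ _ _ _ id).
Qed.

(** The retraction onto the sphere has the identity as differential on tangent
    vectors, so any differentiable extension of G may be differentiated instead. *)
Lemma sderive_tangent {R : realType} {n} (W : normedModType R)
    (G F : 'rV[R]_n.+1 -> W) x v :
  sphere x -> dot v x = 0 -> (forall y, sphere y -> G y = F y) ->
  differentiable F x -> sderive G x v = 'D_v F x.
Proof.
move=> xS vx GF dF; rewrite /sderive.
rewrite (@near_eq_derive _ _ _ _ (F \o @unitize R n.+1)); last first.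
  have := near_neq0 (sphere_neq0 xS); apply: filterS => y y0 /=.
  by apply: GF; exact: unitize_sphere.
have dU := differentiable_unitize (sphere_neq0 xS).
have dF' : differentiable F (unitize x) by rewrite unitize_id.
rewrite deriveE; last exact: differentiable_comp.
rewrite diff_comp//= unitize_id// -[in 'd _ _ _](deriveE v dU).
by have [_ ->] := is_derive_unitize xS vx; rewrite deriveE.
Qed.

(** * The equation in terms of the logarithm *)

(** Here q = - (grad rho) / rho. *)
Lemma position_derive {R : realType} {n} (rho : 'rV[R]_n.+1 -> R) x v :
  Ck_sphere 2 rho -> (forall x, sphere x -> 0 < rho x) ->
  sphere x -> dot v x = 0 ->
  sderive (position rho) x v =
    rho x *: (v - dot (nlog_radial_grad rho x) v *: x).
Proof.
move=> Crho rho0 xS vx; have x0 := sphere_neq0 xS.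
have [dF gF _] := Ck2_has_gradient Crho x0.
rewrite (@sderive_tangent _ _ _ _ (fun y => (rho \o @unitize R n.+1) y *: y)) //; last 2 first.
- by move=> y yS; rewrite /position /= unitize_id.
- exact: (differentiable_scale dF).
have [_ ->] := is_derive_scaler (gF v) (is_derive_id x v).
rewrite /nlog_radial_grad /= unitize_id// dotZl scalerBr scalerA mulNr mulrN mulrA.
by rewrite divff ?gt_eqF ?rho0// mul1r scaleNr opprK addrC.
Qed.

(** The normal is proportional to x + q: both are orthogonal to the tangent
    space of the hypersurface, spanned by the vectors v - <q,v> x. Normalising
    gives N only up to sign, but the reflection is even in N. *)
Lemma reflection_mapE {R : realType} {n} (rho : 'rV[R]_n.+1 -> R) N x
    (q := nlog_radial_grad rho x) :
  Ck_sphere 2 rho -> (forall x, sphere x -> 0 < rho x) ->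
  unit_normal_field rho N -> sphere x ->
  reflection_map N x = x - (2 * (1 + dot q q)^-1) *: (x + q).
Proof.
move=> Crho rho0 hN xS; have /sphereE xx := xS.
have [N1 Nt] := hN x xS.
have x0 := sphere_neq0 xS.
have qx : dot q x = 0.
  apply: (radial_gradient0 (has_gradient_nlog_radial Crho rho0)) => // z.
  by rewrite /nlog_radial unitize_idem.
pose c := dot x (N x).
have Nv v : dot v x = 0 -> dot v (N x) = dot q v * c.
  move=> vx; have := Nt v vx; rewrite position_derive// dotZl => /eqP.
  by rewrite mulf_eq0 gt_eqF ?rho0//= dotDl dotNl dotZl subr_eq0 => /eqP.
clearbody q.
(* N x - c (x + q) is tangent to the sphere, and orthogonal both to N x and to
   x + q, hence to itself. *)
have NE : N x = c *: (x + q).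
  pose D := N x - c *: (x + q).
  have Dx : dot D x = 0 by rewrite /D !dotE xx qx (dotC (N x)) /c; ring.
  apply/eqP; rewrite -subr_eq0 -/D -dot_eq0.
  by rewrite {2}/D dotDr dotNr dotZr dotDr Dx (Nv _ Dx) (dotC q D) add0r mulrC subrr.
have c1 : c ^+ 2 * (1 + dot q q) = 1.
  have /sphereE := N1; rewrite NE !dotE xx (dotC x q) qx => nn; rewrite -[RHS]nn; ring.
rewrite /reflection_map -/c NE scalerA -mulrA -expr2.
congr (_ - (2 * _) *: _).
have q0 : 1 + dot q q != 0 by rewrite gt_eqF// ltr_pwDl// dot_ge0.
by apply: (mulIf q0); rewrite c1 mulVf.
Qed.

(** The coefficient a is left unspecified, because x + q is orthogonal to all
    the vectors against which this derivative is paired in the intensity form. *)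
Lemma reflection_derive {R : realType} {n} (rho : 'rV[R]_n.+1 -> R) N x v
    (q := nlog_radial_grad rho) (c := 2 * (1 + dot (q x) (q x))^-1) :
  Ck_sphere 2 rho -> (forall x, sphere x -> 0 < rho x) ->
  unit_normal_field rho N -> sphere x -> dot v x = 0 ->
  exists a, sderive (reflection_map N) x v =
    v - (a *: (x + q x) + c *: (v + 'D_v q x)).
Proof.
move=> Crho rho0 hN xS vx; have x0 := sphere_neq0 xS.
have [_ _ dq] := has_gradient_nlog_radial Crho rho0 x0.
have q0 : 1 + dot (q x) (q x) != 0 by rewrite gt_eqF// ltr_pwDl// dot_ge0.
have dc : differentiable (fun y => 2 * (1 + dot (q y) (q y))^-1) x.
  apply: differentiableM; first exact: differentiable_cst.
  apply: differentiableV => //; apply: differentiableD; first exact: differentiable_cst.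
  exact: differentiable_dot.
have dp : differentiable (fun y => y + q y) x by exact: differentiableD.
have dcp := differentiable_scale dc dp.
exists ('D_v (fun y => 2 * (1 + dot (q y) (q y))^-1) x).
have did : differentiable (id : 'rV[R]_n.+1 -> _) x by [].
have dG := differentiableB did dcp.
rewrite (sderive_tangent xS vx (fun y yS => reflection_mapE Crho rho0 hN yS) dG).
have dpv := is_deriveD (is_derive_id x v) (is_derive_diff v dq).
have [_ ->] := is_deriveB (is_derive_id x v) (is_derive_scaler (is_derive_diff v dc) dpv).
by [].
Qed.

(** With c = 2 / (1 + |q|^2), the intensity form is the restriction to the tangent
    space of (c - 1) <u,v> + c (D^2 V (u,v) + <u,q> <q,v>), where V = - ln rho.
    Its trace is n (c - 1) + c (Laplacian V + |q|^2), which is solved for the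
    Laplacian. *)
Lemma radial_equation {R : realType} {n} (rho : 'rV[R]_n.+1 -> R) N x lam
    (q := nlog_radial_grad rho) : (1 <= n)%N ->
  Ck_sphere 2 rho -> (forall x, sphere x -> 0 < rho x) ->
  unit_normal_field rho N -> sphere x -> principal_intensities rho N x lam ->
  divergence q x =
    (n%:R + S1 lam) / 2 * (1 + dot (q x) (q x)) - n%:R - dot (q x) (q x).
Proof.
move=> n1 Crho rho0 hN xS [E xE /(S1_trace n1) ->]; have x0 := sphere_neq0 xS.
have /sphereE xx := xS.
have hV := has_gradient_nlog_radial Crho rho0.
have [_ _ dq] := hV x x0.
have Vu z : nlog_radial rho (unitize z) = nlog_radial rho z.
  by rewrite /nlog_radial unitize_idem.
have qx := radial_gradient0 hV Vu x0.
rewrite -/q in dq qx.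
(* Differentiate the relation <q y, y> = 0. *)
have xDq v : dot ('D_v q x) x = - dot (q x) v.
  have := is_derive_dot (is_derive_diff v dq) (is_derive_id x v).
  move=> [_]; rewrite (@near_eq_derive _ _ _ _ (cst 0)) ?derive_cst.
    by move/esym/eqP; rewrite addr_eq0 => /eqP.
  by have := near_neq0 x0; apply: filterS => y y0; exact: radial_gradient0 hV Vu y0.
set c := 2 * (1 + dot (q x) (q x))^-1.
have pE v : dot v x = 0 -> sderive (position rho) x v =
    rho x *: (v - dot (q x) v *: x) by exact: position_derive.
have rE v : dot v x = 0 -> exists a, sderive (reflection_map N) x v =
    v - (a *: (x + q x) + c *: (v + 'D_v q x)) by exact: reflection_derive.
clear hV; clearbody q.
pose J : 'M[R]_n.+1 := \matrix_(i, j) ('D_(delta_mx 0 j) q x) 0 i.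
have JE u v : (u *m J *m v^T) 0 0 = dot u ('D_v q x).
  rewrite -mulmxA -[J *m v^T]trmxK -dot_mx; congr (dot u _).
  rewrite trmx_mul trmxK (deriveE _ dq) {2}(row_sum_delta v) linear_sum.
  apply/rowP => i; rewrite mxE summxE; apply: eq_bigr => j _.
  by rewrite linearZ !mxE deriveE.
pose A : 'M[R]_n.+1 := (c - 1)%:M + c *: (J + (q x)^T *m q x).
have AE u v : (u *m A *m v^T) 0 0 =
    (c - 1) * dot u v + c * (dot u ('D_v q x) + dot u (q x) * dot (q x) v).
  have -> : u *m A *m v^T = (c - 1) *: (u *m v^T)
      + c *: (u *m J *m v^T + (u *m (q x)^T) *m (q x *m v^T)).
    rewrite /A mulmxDr mulmxDl mul_mx_scalar -scalemxAl -scalemxAr -scalemxAl.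
    by rewrite mulmxDr mulmxDl !mulmxA.
  rewrite [LHS]mxE [X in X + _]mxE -dot_mx [X in _ + X]mxE; congr (_ + _ * _).
  by rewrite [LHS]mxE JE; congr (_ + _); rewrite mxE big_ord1 -!dot_mx.
have IE : intensity_mx rho N x E = E *m A *m E^T.
  apply/matrixP => i j; have [_ Ex] := xE.
  have -> : (E *m A *m E^T) i j = (row i E *m A *m (row j E)^T) 0 0.
    by rewrite -row_mul !mxE; apply: eq_bigr => k _; rewrite !mxE.
  rewrite mxE AE pE//; set u := row i E; set v := row j E.
  have [a ->] := rE _ (Ex j).
  rewrite dotZl -mulNr mulrC mulrA mulrN mulVf ?gt_eqF ?rho0// mulN1r.
  rewrite !dotE xx -/v (dotC x v) !Ex (dotC x (q x)) qx (dotC x ('D_v q x)) xDq (dotC (q x) u); ring.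
have trA : \tr A = (c - 1) * n.+1%:R + c * (divergence q x + dot (q x) (q x)).
  rewrite /A mxtraceD mxtraceZ mxtraceD mxtrace_scalar mulr_natr.
  have -> : \tr ((q x)^T *m q x) = dot (q x) (q x).
    by rewrite mxtrace_mulC /mxtrace big_ord1 -dot_mx.
  congr (_ + _ * (_ + _)).
  by apply: eq_bigr => i _; rewrite dot_delta mxE.
have c2 : c * (1 + dot (q x) (q x)) = 2.
  by rewrite /c divfK// gt_eqF// ltr_pwDl// dot_ge0.
rewrite IE (frame_trace _ xS xE) trA AE xx (dotC x ('D_x q x)) xDq qx.
clearbody c; rewrite -[n.+1%:R]natr1; move: c2; clear.
move: (dot _ _) (divergence _ _) (n%:R) => Q dv m c2.
have -> : m + ((c - 1) * (m + 1) + c * (dv + Q) -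
   ((c - 1) * 1 + c * (- 0 + dot x (q x) * 0))) = c * (m + dv + Q) by ring.
have -> : c * (m + dv + Q) / 2 * (1 + Q) = (c * (1 + Q)) * (m + dv + Q) / 2 by ring.
by rewrite c2; field.
Qed.

(** * Regularity of g along rays *)

Lemma enormB_le {R : realType} {n} (u v : 'rV[R]_n) :
  enorm (u - v) <= enorm u + enorm v.
Proof.
rewrite -(@ler_pXn2r _ 2)// ?nnegrE ?addr_ge0 ?enorm_ge0//.
rewrite sqrrD !enorm_sqr !dotE (dotC v u).
by have /ler_normlP[+ _] := cauchy_schwarz u v; lra.
Qed.

Lemma within_id {T : Type} (F : set_system T) {FF : Filter F} (D : set T) :
  F D -> within D F = F.
Proof.
move=> FD; apply/funext => P; apply/propext; split=> [H|H].
  by apply: filterS2 FD H => x Dx; apply.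
by apply: filterS H => x Px _.
Qed.

(** Near an interior point the restriction to [a, b] is void. *)
Lemma derive_on_interior {R : realType} (a b t d : R) (f : R -> R) :
  a < t < b -> is_derive t 1 f d -> derive_on a b f t = d.
Proof.
move=> /andP[at_ tb] [dft dE]; rewrite /derive_on within_id; last first.
  have tab : t \in `]a, b[ by rewrite in_itv/= at_ tb.
  apply: nbhs_dnbhs; apply: filterS (near_in_itvoo tab) => s.
  by rewrite /= !in_itv/= => /andP[/ltW -> /ltW ->].
apply/cvg_lim => //; apply/cvgrPdist_lt => e e0.
have : h^-1 *: (f (h *: 1 + t) - f t) @[h --> 0^'] --> d by rewrite -dE.
move=> /cvgrPdist_lt/(_ e e0)[r /= r0 rP]; exists r => //= s rs st.
have := rP (s - t); rewrite /= sub0r normrN distrC in rP *.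
rewrite [_%:A]mulr1 subrK [_ *: _]mulrC subr_eq0; apply=> //.
Qed.

(** Along a ray, the derivative of g is the component of DG on that ray, and a
    Hoelder continuous field on a bounded set is bounded. So g is Lipschitz in
    its second variable, uniformly, up to the boundary of the annulus. *)
Lemma annulus_radial {R : realType} {n} (alpha R1 R2 : R) (g : 'rV[R]_n.+1 -> R -> R) :
  0 < alpha -> 0 < R1 -> C1alpha_annulus alpha R1 R2 g ->
  exists D : 'rV[R]_n.+1 -> R -> R, exists2 K, 0 <= K &
  forall x, sphere x ->
   [/\ {within `[R1, R2], continuous (g x)},
       forall t, R1 < t < R2 -> is_derive t 1 (g x) (D x t) &
       forall t, R1 < t < R2 -> `|D x t| <= K].
Proof.
move=> alpha0 R10 [Gc [DG [DGd [K KP]]]].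
set A := [set y | _] in Gc KP; set G := fun y => _ in Gc DGd.
have Gx x t : sphere x -> 0 < t -> G (t *: x) = g x t.
  move=> xS t0; rewrite /G unitizeZ// unitize_id// enormZ xS mulr1.
  by rewrite gtr0_norm.
have Ax x t : sphere x -> R1 <= t <= R2 -> A (t *: x).
  move=> xS /andP[R1t tR2]; rewrite /A /= enormZ xS mulr1 ger0_norm ?R1t//.
  exact: le_trans (ltW R10) R1t.
pose e : 'rV[R]_n.+1 := delta_mx 0 0.
have eS : sphere e by apply/sphereE; rewrite dot_delta mxE !eqxx.
pose y0 := R1 *: e.
exists (fun x t => dot (DG (t *: x)) x), (enorm (DG y0) + `|K| * (R2 + R1) `^ alpha).
  by rewrite addr_ge0 ?enorm_ge0// mulr_ge0// powR_ge0.
move=> x xS; split=> [|t /andP[R1t tR2]|t /andP[R1t tR2]].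
- apply/subspace_continuousP => t; rewrite /= in_itv/= => tI B gB.
  have t0 : 0 < t by case/andP : tI => + _; exact: lt_le_trans.
  have /subspace_continuousP/(_ (t *: x) (Ax x t xS tI) B) := Gc.
  rewrite [from_subspace A G _]Gx// => /(_ gB) H.
  have sc : (fun s : R => s *: x) @ t --> t *: x by exact: scalel_continuous.
  suff : nbhs t (fun s : R => s \in `[R1, R2]%R -> B (g x s)) by [].
  have nB : nbhs t (fun s : R => A (s *: x) -> B (G (s *: x))) := sc _ H.
  apply: filterS nB => s sB; rewrite in_itv/= => sI.
  have := sB (Ax x s xS sI); rewrite Gx//.
  by case/andP : sI => + _; exact: lt_le_trans.
- have t0 : 0 < t by exact: lt_trans R1t.
  have tx : R1 < enorm (t *: x) < R2 by rewrite enormZ xS mulr1 gtr0_norm// R1t.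
  have [dG DGE] := DGd _ tx.
  have : is_derive (0 + t *: x) x G (dot (DG (t *: x)) x).
    by rewrite add0r -DGE; exact: is_derive_diff.
  move=> /(is_derive_line G); apply: near_eq_is_derive.
  have tI : t \in `]R1, R2[ by rewrite in_itv/= R1t.
  apply: filterS (near_in_itvoo tI) => s; rewrite in_itv/= => /andP[R1s _].
  by rewrite add0r Gx// (lt_trans R10).
- have := cauchy_schwarz (DG (t *: x) - DG y0) x; rewrite xS mulr1 dotDl dotNl => cs1.
  have := cauchy_schwarz (DG y0) x; rewrite xS mulr1 => cs2.
  have txA : A (t *: x) by apply: Ax => //; rewrite !ltW.
  have y0A : A y0 by apply: Ax => //; rewrite lexx ltW// (lt_trans R1t).
  have := KP _ _ txA y0A.
  have le1 : enorm (t *: x - y0) <= R2 + R1.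
    apply: le_trans (enormB_le _ _) _; rewrite !enormZ xS eS !mulr1.
    by rewrite (gtr0_norm (lt_trans R10 R1t)) (gtr0_norm R10) lerD2r ltW.
  have le2 : K * enorm (t *: x - y0) `^ alpha <= `|K| * (R2 + R1) `^ alpha.
    apply: le_trans (ler_wpM2r (powR_ge0 _ _) (ler_norm K)) _.
    apply: ler_wpM2l => //; apply: ge0_ler_powR; rewrite ?nnegrE ?enorm_ge0//.
      exact: ltW.
    by rewrite (le_trans _ le1)// enorm_ge0.
  move=> /le_trans/(_ le2) le3; have := le_trans cs1 le3.
  move: cs2; rewrite !ler_norml => /andP[a1 a2] /andP[b1 b2]; apply/andP.
  by move: a1 a2 b1 b2; clear; split; lra.
Qed.

(** * Comparison of solutions *)

Lemma lipschitz_derive {R : realType} (f df : R -> R) (a b k : R) :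
  {within `[a, b], continuous f} ->
  (forall t, a < t < b -> is_derive t 1 f (df t)) ->
  (forall t, a < t < b -> `|df t| <= k) ->
  forall s t, a <= s <= b -> a <= t <= b -> `|f s - f t| <= k * `|s - t|.
Proof.
move=> fc fd dfk s t; wlog st : s t / t <= s.
  move=> H sI tI; have [/H|/ltW/H] := leP t s; first exact.
  by rewrite (distrC (f s)) (distrC s); exact.
move=> /andP[_ sb] /andP[at_ _].
have [st'|<-] : t < s \/ t = s by move: st; rewrite le_eqVlt => /orP[/eqP|]; auto.
  have fc' : {within `[t, s], continuous f}.
    by apply: continuous_subspaceW fc; apply: subset_itv; rewrite bnd_simp.
  have I u : u \in `]t, s[%R -> a < u < b.
    by rewrite in_itv/= => /andP[tu us]; rewrite (le_lt_trans at_)// (lt_le_trans us).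
  have [u /I uI ->] := MVT st' (fun u uI => fd u (I u uI)) fc'.
  by rewrite normrM ler_wpM2r// dfk.
by rewrite !subrr normr0 mulr0.
Qed.

(** From ln s <= s - 1 at s = a / b. It converts the distance of rho to R1
    or R2 into the distance of - ln rho to its extremum. *)
Lemma ln_growth {R : realType} (a b c : R) :
  0 < a -> a <= b -> b <= c -> b - a <= c * (ln b - ln a).
Proof.
move=> a0 ab bc; have b0 := lt_le_trans a0 ab.
have : ln (1 + (a / b - 1)) <= a / b - 1.
  by apply: le_ln1Dx; rewrite ltrBrDl subrr divr_gt0.
rewrite addrC subrK ln_div ?posrE// => H.
have H1 : (b - a) / b <= ln b - ln a.
  by rewrite mulrBl divff ?gt_eqF//; move: H; clear; lra.
have H2 : 0 <= ln b - ln a by rewrite subr_ge0 ler_ln ?posrE.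
have -> : b - a = b * ((b - a) / b) by rewrite mulrC divfK// gt_eqF.
exact: le_trans (ler_wpM2l (ltW b0) H1) (ler_wpM2r H2 bc).
Qed.

Lemma solves_equation {R : realType} {n} (g : 'rV[R]_n.+1 -> R -> R) rho
    (q := nlog_radial_grad rho) : (1 <= n)%N ->
  Ck_sphere 2 rho -> (forall x, sphere x -> 0 < rho x) -> solves g rho ->
  forall x, sphere x -> divergence q x =
    n%:R * (1 + g x (rho x)) / 2 * (1 + dot (q x) (q x)) - n%:R - dot (q x) (q x).
Proof.
move=> n1 Crho rho0 [N hN Neq] x xS; have [lam plam lamE] := Neq x xS.
by rewrite (radial_equation n1 Crho rho0 hN xS plam) lamE -{1}[n%:R]mulr1 -mulrDr.
Qed.

Lemma field_bounded {R : realType} {n} (W : 'rV[R]_n.+1 -> R) q : has_gradient W q ->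
  exists2 L, 0 <= L & forall x, sphere x -> enorm (q x) <= L.
Proof.
move=> hW.
have [||c cS cmax] := @compact_sphere_max R n (fun y => enorm (q y)) _ (@subset_refl _ _) sphere_compact.
- by exists (delta_mx 0 0); apply/sphereE; rewrite dot_delta mxE !eqxx.
- move=> x /sphere_neq0 /hW[_ _ /differentiable_continuous qc].
  exact: (@continuous_comp _ _ _ q (@enorm R n.+1) _ qc (@enorm_continuous R n _)).
by exists (enorm (q c)); [exact: enorm_ge0|exact: cmax].
Qed.

Lemma nlog_radialE {R : realType} {n} (rho : 'rV[R]_n.+1 -> R) x :
  sphere x -> nlog_radial rho x = - ln (rho x).
Proof. by move=> xS; rewrite /nlog_radial unitize_id. Qed.

Lemma nlog_radial_unitize {R : realType} {n} (rho : 'rV[R]_n.+1 -> R) y :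
  nlog_radial rho (unitize y) = nlog_radial rho y.
Proof. by rewrite /nlog_radial unitize_idem. Qed.

Lemma divergenceN {R : realType} {n} (q : 'rV[R]_n.+1 -> 'rV[R]_n.+1) x :
  differentiable q x -> divergence (fun y => -1 *: q y) x = - divergence q x.
Proof.
move=> dq; have c0 v : is_derive x v (fun=> -1 : R) (dot 0 v).
  by rewrite dot0l; exact: is_derive_cst.
by rewrite (divergence_scale c0 dq) dot0l add0r mulN1r.
Qed.

(** For V_i = - ln rho_i, the difference W = V_1 - V_2 has a positive maximum.
    Where W is positive, rho_1 < rho_2, hence g at rho_1 is at least g at rho_2,
    and subtracting the equations leaves only gradient terms, bounded by a
    multiple of the gradient of W. By the strong maximum principle W is constant. *)
Lemma solutions_homothetic {R : realType} {n} (g : 'rV[R]_n.+1 -> R -> R)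
    (R1 R2 G : R) rho1 rho2 : (1 <= n)%N -> 0 < R1 ->
  (forall x t, sphere x -> R1 <= t <= R2 -> 0 < g x t <= G) ->
  (forall x s t, sphere x -> R1 <= s -> s <= t -> t <= R2 -> g x t <= g x s) ->
  Ck_sphere 2 rho1 -> Ck_sphere 2 rho2 ->
  (forall x, sphere x -> R1 <= rho1 x <= R2) ->
  (forall x, sphere x -> R1 <= rho2 x <= R2) ->
  solves g rho1 -> solves g rho2 ->
  (exists2 x, sphere x & rho1 x < rho2 x) ->
  exists2 C, 0 < C & forall x, sphere x -> rho1 x = C * rho2 x.
Proof.
move=> n1 R10 gG gdecr C1 C2 I1 I2 s1 s2 [z zS z12].
have p1 x : sphere x -> 0 < rho1 x.
  by move=> /I1/andP[+ _]; exact: lt_le_trans.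
have p2 x : sphere x -> 0 < rho2 x.
  by move=> /I2/andP[+ _]; exact: lt_le_trans.
have hV1 := has_gradient_nlog_radial C1 p1.
have hV2 := has_gradient_nlog_radial C2 p2.
have E1 := solves_equation n1 C1 p1 s1.
have E2 := solves_equation n1 C2 p2 s2.
set V1 := nlog_radial rho1 in hV1; set V2 := nlog_radial rho2 in hV2.
set q1 := nlog_radial_grad rho1 in hV1 E1; set q2 := nlog_radial_grad rho2 in hV2 E2.
clearbody q1 q2.
have hW := has_gradientD hV1 (has_gradientZ (-1) hV2).
set W := (fun y => V1 y + _) in hW; set q := (fun y => q1 y + _) in hW.
have [L L0 qL] := field_bounded (has_gradientD hV1 hV2).
have WE x : sphere x -> W x = ln (rho2 x) - ln (rho1 x).
  by move=> xS; rewrite /W /V1 /V2 !nlog_radialE//; ring.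
have [||c cS cmax] := @compact_sphere_max R n W _ (@subset_refl _ _) sphere_compact.
- by exists z.
- by move=> x /sphere_neq0 /hW[/differentiable_continuous].
have Wc0 : 0 < W c.
  by apply: lt_le_trans (cmax z zS); rewrite WE// subr_gt0 ltr_ln ?posrE ?p1 ?p2.
have n0 : 0 <= n%:R :> R by exact: ler0n.
have G0 : 0 <= G.
  by have /andP[g0 /(le_trans (ltW g0))] := gG z _ zS (I1 z zS).
pose B := (n%:R * (1 + G) / 2 + 1) * L.
have Wconst : forall x, sphere x -> W x = W c.
  apply: (@strong_maximum R n W q (W c) (W c) 0 B) => //.
  - by move=> y; rewrite /W /V1 /V2 !nlog_radial_unitize.
  - by rewrite mulr_ge0// addr_ge0// divr_ge0// mulr_ge0// addr_ge0.
  - move=> x xS; rewrite subrr oppr0 mul0r add0r WE// subr_gt0.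
    rewrite ltr_ln ?posrE ?p1 ?p2// => r12.
    have [_ _ d1] := hV1 x (sphere_neq0 xS).
    have [_ _ d2] := hV2 x (sphere_neq0 xS).
    have d2' : differentiable (fun y => -1 *: q2 y) x.
      by apply: differentiable_scale => //; exact: differentiable_cst.
    rewrite /q (divergenceD d1 d2') (divergenceN d2) E1// E2// scaleN1r.
    have /andP[R1r _] := I1 x xS; have /andP[_ R2r] := I2 x xS.
    have g12 := gdecr x _ _ xS R1r (ltW r12) R2r.
    have /andP[g0 gle] := gG x _ xS (I2 x xS).
    move: (g x (rho1 x)) (g x (rho2 x)) g12 g0 gle => g1 g2 g12 g20 g2G.
    have Q10 := dot_ge0 (q1 x).
    have QE : dot (q1 x) (q1 x) - dot (q2 x) (q2 x) = dot (q1 x - q2 x) (q1 x + q2 x).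
      by rewrite !dotE (dotC (q2 x) (q1 x)); ring.
    have QL : `|dot (q1 x) (q1 x) - dot (q2 x) (q2 x)| <= enorm (q1 x - q2 x) * L.
      rewrite QE; apply: le_trans (cauchy_schwarz _ _) _.
      by apply: ler_wpM2l; [exact: enorm_ge0|exact: qL].
    set Q1 := dot (q1 x) _ in Q10 QL *; set Q2 := dot (q2 x) _ in QL *.
    set e := enorm _ in QL *.
    have e1 : n%:R * (1 + g2) / 2 * (1 + Q1) <= n%:R * (1 + g1) / 2 * (1 + Q1).
      apply: ler_wpM2r; first by rewrite addr_ge0.
      by rewrite ler_wpM2r// ler_wpM2l// lerD2l.
    have e2 : `|(n%:R * (1 + g2) / 2 - 1) * (Q1 - Q2)| <= B * e.
      have -> : B * e = (n%:R * (1 + G) / 2 + 1) * (e * L).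
        by rewrite /B -[LHS]mulrA (mulrC L).
      rewrite normrM; apply: ler_pM => //.
      apply: le_trans (ler_normB _ _) _; rewrite normr1 lerD2r ger0_norm.
        by rewrite ler_wpM2r// ler_wpM2l// lerD2l.
      by rewrite divr_ge0// mulr_ge0// addr_ge0// ltW.
    move: e2; rewrite ler_norml => /andP[e2 _].
    move: e1 e2; clear; move: (B * e) (n%:R) => b m; rewrite !mulrDr !mulr1; lra.
  - by exists c.
exists (expR (- W c)); first exact: expR_gt0.
move=> x xS; rewrite -(Wconst x xS) WE// opprB expRD expRN.
by rewrite !lnK ?posrE ?p1 ?p2// divfK// gt_eqF// p2.
Qed.

(** V = - ln rho has the maximum - ln R1. Since g >= 1 at R1, g can fall below 1
    by no more than a multiple of rho - R1, that is of - ln R1 - V; the gradient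
    terms are quadratic, hence controlled by a multiple of the gradient. *)
Lemma constant_of_touching_inner {R : realType} {n} (g : 'rV[R]_n.+1 -> R -> R)
    (R1 R2 K : R) rho : (1 <= n)%N -> 0 < R1 -> 0 <= K ->
  (forall x t, sphere x -> R1 <= t <= R2 -> 0 < g x t) ->
  (forall x t, sphere x -> R1 <= t <= R2 -> 1 - K * (t - R1) <= g x t) ->
  Ck_sphere 2 rho -> (forall x, sphere x -> R1 <= rho x <= R2) ->
  solves g rho -> (exists2 x, sphere x & rho x = R1) ->
  forall x, sphere x -> rho x = R1.
Proof.
move=> n1 R10 K0 g0 gK Crho Irho s [z zS z1].
have p x : sphere x -> 0 < rho x.
  by move=> /Irho/andP[+ _]; exact: lt_le_trans.
have R20 : 0 < R2 by have /andP[_] := Irho z zS; apply: lt_le_trans; exact: p.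
have hV := has_gradient_nlog_radial Crho p.
have E := solves_equation n1 Crho p s.
have [L L0 qL] := field_bounded hV.
have n0 : 0 <= n%:R :> R by exact: ler0n.
have VE : forall x, sphere x -> nlog_radial rho x = - ln R1.
  apply: (@strong_maximum R n _ _ (- ln R1) 1 (n%:R * K * R2 / 2) L n1 hV) => //.
  - exact: nlog_radial_unitize.
  - by rewrite divr_ge0// !mulr_ge0// ltW.
  - move=> x xS; rewrite nlog_radialE// lerN2 ler_ln ?posrE ?p//.
    by have /andP[] := Irho x xS.
  - move=> x xS _; rewrite E// nlog_radialE//.
    have /andP[r1 r2] := Irho x xS.
    have := ln_growth R10 r1 r2; have := gK x _ xS (Irho x xS).
    have := g0 x _ xS (Irho x xS); move: (g x _) => gx gx0 gxK lnr.
    rewrite -enorm_sqr; have := qL x xS; have := enorm_ge0 (nlog_radial_grad rho x).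
    move: (enorm _) => e e0 eL.
    have a1 : K * (rho x - R1) <= K * (R2 * (ln (rho x) - ln R1)) by rewrite ler_wpM2l.
    have a2 : n%:R * (1 - K * (R2 * (ln (rho x) - ln R1))) <= n%:R * gx.
      by rewrite ler_wpM2l//; move: a1 gxK; clear; lra.
    have a3 : e ^+ 2 <= L * e by rewrite expr2 ler_wpM2r.
    have a4 : 0 <= n%:R * (1 + gx) / 2 * e ^+ 2.
      by rewrite mulr_ge0 ?sqr_ge0// divr_ge0// mulr_ge0// addr_ge0// ltW.
    move: a2 a3 a4; clear; lra.
  - by exists z => //; rewrite nlog_radialE// z1.
move=> x xS; have := VE x xS; rewrite nlog_radialE// => /oppr_inj.
by apply: ln_inj; rewrite posrE// p.
Qed.

(** The mirror image of the previous lemma, applied to - V = ln rho at its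
    maximum ln R2. *)
Lemma constant_of_touching_outer {R : realType} {n} (g : 'rV[R]_n.+1 -> R -> R)
    (R1 R2 K G : R) rho : (1 <= n)%N -> 0 < R1 -> 0 <= K ->
  (forall x t, sphere x -> R1 <= t <= R2 -> 0 < g x t <= G) ->
  (forall x t, sphere x -> R1 <= t <= R2 -> g x t <= 1 + K * (R2 - t)) ->
  Ck_sphere 2 rho -> (forall x, sphere x -> R1 <= rho x <= R2) ->
  solves g rho -> (exists2 x, sphere x & rho x = R2) ->
  forall x, sphere x -> rho x = R2.
Proof.
move=> n1 R10 K0 gG gK Crho Irho s [z zS z2].
have p x : sphere x -> 0 < rho x.
  by move=> /Irho/andP[+ _]; exact: lt_le_trans.
have R20 : 0 < R2 by rewrite -z2 p.
have hV := has_gradient_nlog_radial Crho p.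
have hW := has_gradientZ (-1) hV.
have E := solves_equation n1 Crho p s.
have [L L0 qL] := field_bounded hV.
have n0 : 0 <= n%:R :> R by exact: ler0n.
have G0 : 0 <= G.
  by have /andP[g0 /(le_trans (ltW g0))] := gG z _ zS (Irho z zS).
have WE : forall x, sphere x -> -1 * nlog_radial rho x = ln R2.
  apply: (@strong_maximum R n _ _ (ln R2) 1 (n%:R * K * R2 / 2)
            (n%:R * (1 + G) / 2 * L) n1 hW) => //.
  - by move=> y; rewrite nlog_radial_unitize.
  - by rewrite divr_ge0// !mulr_ge0// ltW.
  - by rewrite mulr_ge0// divr_ge0// mulr_ge0// addr_ge0.
  - move=> x xS; rewrite nlog_radialE// mulN1r opprK ler_ln ?posrE ?p//.
    by have /andP[] := Irho x xS.
  - move=> x xS _; have [_ _ dq] := hV x (sphere_neq0 xS).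
    rewrite (divergenceN dq) E// nlog_radialE// mulN1r opprK scaleN1r.
    have /andP[r1 r2] := Irho x xS.
    have := ln_growth (p x xS) r2 (lexx R2); have := gK x _ xS (Irho x xS).
    have /andP[] := gG x _ xS (Irho x xS); move: (g x _) => gx gx0 gxG gxK lnr.
    rewrite -enorm_sqr -scaleN1r enormZ normrN1 mul1r.
    have := qL x xS; have := enorm_ge0 (nlog_radial_grad rho x).
    move: (enorm _) => e e0 eL.
    have a1 : K * (R2 - rho x) <= K * (R2 * (ln R2 - ln (rho x))) by rewrite ler_wpM2l.
    have a2 : n%:R * gx <= n%:R * (1 + K * (R2 * (ln R2 - ln (rho x)))).
      by rewrite ler_wpM2l//; move: a1 gxK; clear; lra.
    have a3 : e ^+ 2 <= L * e by rewrite expr2 ler_wpM2r.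
    have a4 : n%:R * (1 + gx) / 2 * e ^+ 2 <= n%:R * (1 + G) / 2 * (L * e).
      apply: ler_pM; rewrite ?sqr_ge0//.
        by rewrite divr_ge0// mulr_ge0// addr_ge0// ltW.
      by rewrite ler_wpM2r// ler_wpM2l// lerD2l.
    have a5 := sqr_ge0 e.
    move: a2 a4 a5; clear; lra.
  - by exists z => //; rewrite nlog_radialE// z2 mulN1r opprK.
move=> x xS; have := WE x xS; rewrite nlog_radialE// mulN1r opprK.
by apply: ln_inj; rewrite posrE// p.
Qed.

(** * The theorem *)

Theorem proposition5 (R : realType) (n : nat) (alpha R1 R2 : R)
    (g : 'rV[R]_n.+1 -> R -> R)
    (hn : (1 <= n)%N)
    (halpha : 0 < alpha < 1)
    (hR1 : 0 < R1) (hR12 : R1 < R2)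
    (hgpos : forall (x : 'rV[R]_n.+1) (t : R),
       sphere x -> R1 <= t <= R2 -> 0 < g x t)
    (hgreg : C1alpha_annulus alpha R1 R2 g)
    (hi : forall x : 'rV[R]_n.+1, sphere x -> 1 <= g x R1)
    (hii : forall x : 'rV[R]_n.+1, sphere x -> g x R2 <= 1) :
  (forall (M1 M2 : set 'rV[R]_n.+1) (rho1 rho2 : 'rV[R]_n.+1 -> R),
     is_radial_function M1 rho1 ->
     is_radial_function M2 rho2 ->
     (forall x, sphere x -> R1 <= rho1 x <= R2) ->
     (forall x, sphere x -> R1 <= rho2 x <= R2) ->
     solves g rho1 ->
     solves g rho2 ->
     (forall (x : 'rV[R]_n.+1) (t : R), sphere x -> R1 <= t <= R2 ->
        derive_on R1 R2 (g x) t <= 0) ->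
     exists C : R, 0 < C /\ forall x, sphere x -> rho1 x = C * rho2 x) /\
  (forall rho : 'rV[R]_n.+1 -> R,
     Ck_sphere 2 rho ->
     (forall x, sphere x -> R1 <= rho x <= R2) ->
     solves g rho ->
     [\/ forall x, sphere x -> rho x = R1,
         forall x, sphere x -> rho x = R2
       | forall x, sphere x -> R1 < rho x < R2]).
Proof.
have /andP[alpha0 _] := halpha.
have [D [K K0 HD]] := annulus_radial alpha0 hR1 hgreg.
have gLip x s t : sphere x -> R1 <= s <= R2 -> R1 <= t <= R2 ->
    `|g x s - g x t| <= K * `|s - t|.
  by move=> /HD[gc gd gK]; exact: lipschitz_derive gc gd gK s t.
have inner x t : sphere x -> R1 <= t <= R2 -> 1 - K * (t - R1) <= g x t.
  move=> xS /[dup] tI /andP[R1t _].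
  have := gLip x t R1 xS tI; rewrite lexx ltW// => /(_ isT).
  rewrite (ger0_norm (_ : 0 <= t - R1)) ?subr_ge0// => /ler_normlP[H _].
  by move: (hi x xS) H; clear; lra.
have outer x t : sphere x -> R1 <= t <= R2 -> g x t <= 1 + K * (R2 - t).
  move=> xS /[dup] tI /andP[_ tR2].
  have := gLip x t R2 xS tI; rewrite lexx ltW// => /(_ isT).
  rewrite (distrC t) (ger0_norm (_ : 0 <= R2 - t)) ?subr_ge0// => /ler_normlP[_ H].
  by move: (hii x xS) H; clear; lra.
pose G := 1 + K * (R2 - R1).
have gG x t : sphere x -> R1 <= t <= R2 -> 0 < g x t <= G.
  move=> xS tI; rewrite hgpos//=; apply: le_trans (outer x t xS tI) _.
  by have /andP[R1t _] := tI; rewrite /G lerD2l ler_wpM2l// lerB.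
split=> [M1 M2 rho1 rho2 [C1 _ _] [C2 _ _] I1 I2 s1 s2 dg|rho Crho Irho s].
  have gdecr x s t : sphere x -> R1 <= s -> s <= t -> t <= R2 -> g x t <= g x s.
    move=> xS R1s st tR2; have [gc gd _] := HD x xS.
    apply: (@ler0_derive1_le_cc _ (g x) R1 R2) => //.
    - by move=> u; rewrite in_itv/= => /gd[].
    - move=> u; rewrite in_itv/= => uI; have du := gd u uI.
      rewrite derive1E; have [_ ->] := du.
      rewrite -(derive_on_interior uI du); apply: dg => //.
      by case/andP : uI => /ltW -> /ltW ->.
    - by rewrite in_itv/= (le_trans R1s st).
    - by rewrite in_itv/= R1s (le_trans st).
  have [H12|N12] := pselect (exists2 x, sphere x & rho1 x < rho2 x).
    have [C C0 CE] := solutions_homothetic hn hR1 gG gdecr C1 C2 I1 I2 s1 s2 H12.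
    by exists C.
  have [H21|N21] := pselect (exists2 x, sphere x & rho2 x < rho1 x).
    have [C C0 CE] := solutions_homothetic hn hR1 gG gdecr C2 C1 I2 I1 s2 s1 H21.
    exists C^-1; split=> [|x xS]; first by rewrite invr_gt0.
    by rewrite CE// mulKf// gt_eqF.
  exists 1; split=> // x xS; rewrite mul1r; apply/eqP; rewrite eq_le !leNgt.
  by apply/andP; split; apply/negP => H; [apply: N21|apply: N12]; exists x.
have [H1|N1] := pselect (exists2 x, sphere x & rho x = R1).
  by constructor 1; exact: constant_of_touching_inner hn hR1 K0 hgpos inner Crho Irho s H1.
have [H2|N2] := pselect (exists2 x, sphere x & rho x = R2).
  by constructor 2; exact: constant_of_touching_outer hn hR1 K0 gG outer Crho Irho s H2.
constructor 3 => x xS; have /andP[r1 r2] := Irho x xS.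
rewrite !lt_neqAle r1 r2 !andbT; apply/andP; split; apply/eqP => H.
  by apply: N1; exists x.
by apply: N2; exists x.
Qed.
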